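(* For every integer $k\ge2$, a $k$-graph property $\mathbf P$ is testable if and only if it is estimable.
   Context: A $k$-graph is a $k$-uniform hypergraph, identified with its edge set. For $k$-graphs $G,H$ on a common vertex set of size $n$, $G$ and $H$ are $\alpha$-close if $|G\triangle H|\le\alpha\binom nk$, and $\alpha$-far otherwise. A $k$-graph property is a decidable, isomorphism-closed class of $k$-graphs. An $n$-vertex $k$-graph $H$ is $\alpha$-close to satisfying a property $\mathbf P$ if some $k$-graph on $V(H)$ satisfying $\mathbf P$ is $\alpha$-close to $H$, and $\alpha$-far from satisfying $\mathbf P$ otherwise. $\mathbf P$ is testable if there is a function $q:(0,1)\to\mathbb N$ such that for every $n$ and every $\alpha\in(0,1)$ there is a randomized algorithm which, given an $n$-vertex $k$-graph $H$ accessible only via edge queries (asking whether a given $k$-set is an edge), makes at most $q(\alpha)$ queries, accepts with probability at least $2/3$ if $H$ satisfies $\mathbf P$, and rejects with probability at least $2/3$ if $H$ is $\alpha$-far from satisfying $\mathbf P$. $\mathbf P$ is estimable if there is $q:(0,1)^2\to\mathbb N$ such that for every $n$ and all $0<\beta<\alpha<1$ there is a randomized algorithm making at most $q(\alpha,\beta)$ edge queries that accepts with probability at least $2/3$ every $n$-vertex $k$-graph that is $(\alpha-\beta)$-close to satisfying $\mathbf P$ and rejects with probability at least $2/3$ every $n$-vertex $k$-graph that is $\alpha$-far from satisfying $\mathbf P$. *)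

(* Defs.v *)
From HB Require Import structures.
From mathcomp Require Import all_boot all_fingroup.
From Stdlib Require Import Reals.

Set Implicit Arguments.
Unset Strict Implicit.
Unset Printing Implicit Defensive.

Definition hgraph (n : nat) := {set {set 'I_n}}.

Definition is_kgraph (k n : nat) (H : hgraph n) : bool :=
  [forall e in H, #|e| == k].

Definition symdiff (n : nat) (G H : hgraph n) : hgraph n :=
  (G :\: H) :|: (H :\: G).

Definition close (k n : nat) (alpha : R) (G H : hgraph n) : Prop :=
  (INR #|symdiff G H| <= alpha * INR 'C(n, k))%R.

(* A k-graph property: a (decidable, i.e. boolean) class of k-graphs for each
   vertex number n; only its values on k-graphs matter. *)
Definition kproperty := forall n : nat, hgraph n -> bool.

Definition relabel (n : nat) (s : {perm 'I_n}) (H : hgraph n) : hgraph n :=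
  [set [set s x | x in e] | e : {set 'I_n} in H].

Definition iso_closed (k : nat) (P : kproperty) : Prop :=
  forall (n : nat) (s : {perm 'I_n}) (H : hgraph n),
    is_kgraph k H -> P n (relabel s H) = P n H.

Definition close_to (k : nat) (P : kproperty) (n : nat) (alpha : R)
    (H : hgraph n) : Prop :=
  exists G : hgraph n, is_kgraph k G /\ P n G /\ close k alpha G H.

(* Deterministic adaptive edge-query algorithms = decision trees. *)
Inductive qtree (n : nat) : Type :=
| Leaf : bool -> qtree n
| Query : {set 'I_n} -> qtree n -> qtree n -> qtree n.
(* Query e t0 t1 : ask whether e is an edge; continue with t1 if yes, t0 if no *)

Fixpoint qdepth (n : nat) (t : qtree n) : nat :=
  match t with
  | Leaf _ => 0
  | Query _ t0 t1 => (maxn (qdepth t0) (qdepth t1)).+1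
  end.

Fixpoint queries_ksets (k n : nat) (t : qtree n) : bool :=
  match t with
  | Leaf _ => true
  | Query e t0 t1 => (#|e| == k) && queries_ksets k t0 && queries_ksets k t1
  end.

Fixpoint run (n : nat) (t : qtree n) (H : hgraph n) : bool :=
  match t with
  | Leaf b => b
  | Query e t0 t1 => if e \in H then run t1 H else run t0 H
  end.

(* Randomized algorithm making at most q queries: a finitely supported
   probability distribution over deterministic query trees of depth <= q. *)
Definition ralg (n : nat) := seq (R * qtree n).

Definition valid_ralg (k n : nat) (q : nat) (A : ralg n) : Prop :=
  foldr (fun p acc => ((0 <= p.1)%R /\ (qdepth p.2 <= q)%N /\
                        queries_ksets k p.2) /\ acc) True A /\
  foldr (fun p acc => p.1 + acc)%R 0%R A = 1%R.

Definition accept_prob (n : nat) (A : ralg n) (H : hgraph n) : R :=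
  foldr (fun p acc => (if run p.2 H then p.1 else 0) + acc)%R 0%R A.

Definition testable (k : nat) (P : kproperty) : Prop :=
  exists q : R -> nat,
    forall (n : nat) (alpha : R), (0 < alpha < 1)%R ->
      exists A : ralg n, valid_ralg k (q alpha) A /\
        (forall H : hgraph n, is_kgraph k H -> P n H ->
            (2 / 3 <= accept_prob A H)%R) /\
        (forall H : hgraph n, is_kgraph k H -> ~ close_to k P alpha H ->
            (1 - accept_prob A H >= 2 / 3)%R).

Definition estimable (k : nat) (P : kproperty) : Prop :=
  exists q : R -> R -> nat,
    forall (n : nat) (alpha beta : R), (0 < beta)%R -> (beta < alpha)%R ->
      (alpha < 1)%R ->
      exists A : ralg n, valid_ralg k (q alpha beta) A /\
        (forall H : hgraph n, is_kgraph k H -> close_to k P (alpha - beta) H ->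
            (2 / 3 <= accept_prob A H)%R) /\
        (forall H : hgraph n, is_kgraph k H -> ~ close_to k P alpha H ->
            (1 - accept_prob A H >= 2 / 3)%R).

(* Main.v *)
Require Import Defs.
From mathcomp Require Import all_boot all_fingroup.
From Stdlib Require Import Reals.
From mathcomp Require Import all_order all_algebra Rstruct ring lra zify boolp ssrnat.

(* Only "testable implies estimable" needs an argument.  Averaging a tester over
   all relabellings turns it into the mean of a function [phi] of the pattern
   induced on [r] random vertices.  The estimator looks at a random map [f] from a
   large fixed set [V] to the vertices and accepts iff some graph [y] on [V] is
   such that most small samples of the pair (pullback of [H], [y]) look accepted
   by the tester and close to each other.  Completeness is a second moment bound.

   For soundness, the choice of [y] on each random sample must be lifted to a
   single graph [G] on the whole vertex set with nearly the same small samples;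
   no hypergraph regularity is needed.  Condition on a random core [S] of vertices
   and sample, for [j = 0, ..., k], the label of every [j]-set [A] (the edges that
   consist of [A] and vertices of [S]) from its conditional law given the labels of
   the proper subsets of [A], independently for distinct [A].  Lower levels use
   larger cores.  By exchangeability, if this conditional independence failed
   noticeably then enlarging the cores would increase the energy (the mean square
   of the conditional probabilities) of the labels, and energies are bounded, so
   some choice of core sizes, bounded independently of [n], works. *)

Set Implicit Arguments.
Unset Strict Implicit.
Unset Printing Implicit Defensive.
Import Order.TTheory GRing.Theory Num.Theory.
Local Open Scope ring_scope.

(** * Energy and product weights *)

Section Energy.
Variables (R : realFieldType) (W : finType) (P : W -> R).
Hypotheses (P_ge0 : forall w, 0 <= P w) (P_sum : \sum_w P w = 1).

Definition pr (X : finType) (f : W -> X) (x : X) : R := \sum_(w | f w == x) P w.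

Definition pr2 (X L : finType) (f : W -> X) (Y : W -> L) (x : X) (l : L) : R :=
  \sum_(w | (f w == x) && (Y w == l)) P w.

(** The mean square of the conditional probabilities of the values of [Y] given [f]. Values of [f]
    of weight zero contribute 0, since dividing by 0 gives 0. *)
Definition energy (X L : finType) (Y : W -> L) (f : W -> X) : R :=
  \sum_x \sum_l pr2 f Y x l ^+ 2 / pr f x.

(** On a null value of [f] the law is set to the point mass at [l0], so that it has total mass 1 for
    every [x], and so have products of such laws. *)
Definition condp (X L : finType) (Y : W -> L) (f : W -> X) (l0 : L) (x : X) (l : L) : R :=
  if pr f x == 0 then (l == l0)%:R else pr2 f Y x l / pr f x.

Lemma pr_ge0 (X : finType) (f : W -> X) x : 0 <= pr f x.
Proof. exact: sumr_ge0. Qed.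

Lemma pr2_ge0 (X L : finType) (f : W -> X) (Y : W -> L) x l : 0 <= pr2 f Y x l.
Proof. exact: sumr_ge0. Qed.

Lemma expect_pr (X : finType) (f : W -> X) (K : X -> R) :
  \sum_w P w * K (f w) = \sum_x pr f x * K x.
Proof.
rewrite (partition_big f predT) //=; apply: eq_bigr => x _.
by rewrite mulr_suml; apply: eq_bigr => w /eqP ->.
Qed.

Lemma expect_pr2 (X L : finType) (f : W -> X) (Y : W -> L) (K : X -> L -> R) :
  \sum_w P w * K (f w) (Y w) = \sum_x \sum_l pr2 f Y x l * K x l.
Proof.
rewrite (partition_big f predT) //=; apply: eq_bigr => x _.
rewrite (partition_big Y predT) //=; apply: eq_bigr => l _.
by rewrite mulr_suml; apply: eq_bigr => w /andP[/eqP -> /eqP ->].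
Qed.

Lemma pr2_suml (X L : finType) (f : W -> X) (Y : W -> L) x :
  \sum_l pr2 f Y x l = pr f x.
Proof. by rewrite /pr (partition_big Y predT). Qed.

Lemma pr2_le (X L : finType) (f : W -> X) (Y : W -> L) x l : pr2 f Y x l <= pr f x.
Proof.
rewrite -(pr2_suml f Y) (bigD1 l) //= lerDl; apply: sumr_ge0 => *; exact: pr2_ge0.
Qed.

Lemma pr_sum (X : finType) (f : W -> X) : \sum_x pr f x = 1.
Proof. by rewrite -P_sum (partition_big f predT). Qed.

Lemma pr_comp (X C : finType) (f : W -> X) (h : X -> C) c :
  pr (fun w => h (f w)) c = \sum_(x | h x == c) pr f x.
Proof.
rewrite /pr (partition_big f (fun x => h x == c)) //=.
apply: eq_bigr => x /eqP hx; apply: eq_bigl => w.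
by case: (f w =P x) => [->|]; rewrite ?andbF // hx eqxx.
Qed.

Lemma pr2_comp (X C L : finType) (f : W -> X) (Y : W -> L) (h : X -> C) c l :
  pr2 (fun w => h (f w)) Y c l = \sum_(x | h x == c) pr2 f Y x l.
Proof.
rewrite /pr2 (partition_big f (fun x => h x == c)) /=; last by move=> w /andP[].
apply: eq_bigr => x /eqP hx; apply: eq_bigl => w.
by case: (f w =P x) => [->|]; rewrite ?andbF // hx eqxx andbT.
Qed.

Lemma condp_ge0 (X L : finType) (Y : W -> L) (f : W -> X) l0 x l :
  0 <= condp Y f l0 x l.
Proof.
rewrite /condp; case: ifP => _; first exact: ler0n.
by rewrite divr_ge0 ?pr2_ge0 ?pr_ge0.
Qed.

Lemma condp_sum (X L : finType) (Y : W -> L) (f : W -> X) l0 x :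
  \sum_l condp Y f l0 x l = 1.
Proof.
rewrite /condp; case: (pr f x =P 0) => [_|/eqP h].
  by rewrite (bigD1 l0) //= eqxx big1 ?addr0 // => l /negPf ->.
by rewrite -mulr_suml pr2_suml divff.
Qed.

Lemma condpM (X L : finType) (Y : W -> L) (f : W -> X) l0 x l :
  pr f x * condp Y f l0 x l = pr2 f Y x l.
Proof.
rewrite /condp; case: eqP => [h|/eqP h]; last by rewrite mulrCA divff ?mulr1.
rewrite h mul0r; apply/eqP; rewrite eq_le pr2_ge0 /=.
by rewrite -h pr2_le.
Qed.

(** Pythagoras: conditioning on the coarser [h (f w)] is an orthogonal projection, so the energy
    lost is the weighted squared distance between the two conditional laws. *)
Lemma energyB (X C L : finType) (f : W -> X) (Y : W -> L) (h : X -> C) l0 :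
  energy Y f - energy Y (fun w => h (f w)) =
  \sum_x \sum_l (pr2 f Y x l - pr f x * condp Y (fun w => h (f w)) l0 (h x) l) ^+ 2
                / pr f x.
Proof.
set g := fun w => h (f w); set q := condp Y g l0.
have sq x l : (pr2 f Y x l - pr f x * q (h x) l) ^+ 2 / pr f x =
    pr2 f Y x l ^+ 2 / pr f x + (pr f x * q (h x) l ^+ 2
                                 - 2 * (pr2 f Y x l * q (h x) l)).
  have [p0|p0] := eqVneq (pr f x) 0; last by field.
  have -> : pr2 f Y x l = 0.
    by apply/eqP; rewrite eq_le pr2_ge0 andbT -p0 pr2_le.
  by rewrite p0; ring.
(* On each fibre of [h] the factor [q] is constant, so the cross terms sum to twice the energy of
   [g] and the square terms to once that energy. *)
have -> : energy Y g = \sum_x \sum_l (2 * (pr2 f Y x l * q (h x) l)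
                                 - pr f x * q (h x) l ^+ 2).
  rewrite [RHS](partition_big h predT) //=; apply: eq_bigr => c _.
  rewrite exchange_big /=; apply: eq_bigr => l _.
  transitivity (2 * ((\sum_(x | h x == c) pr2 f Y x l) * q c l)
     - (\sum_(x | h x == c) pr f x) * q c l ^+ 2); last first.
    by rewrite !mulr_suml mulr_sumr -sumrB; apply: eq_bigr => x /eqP ->.
  rewrite -pr_comp -pr2_comp -/g -(condpM Y g l0) -/q.
  by have [->|p0] := eqVneq (pr g c) 0; [ring | field].
rewrite -sumrB; apply: eq_bigr => x _.
by rewrite -sumrB; apply: eq_bigr => l _; rewrite sq; ring.
Qed.

Lemma energy_ge0 (X L : finType) (Y : W -> L) (f : W -> X) : 0 <= energy Y f.
Proof.
by do 2!apply: sumr_ge0 => ? _; rewrite divr_ge0 ?sqr_ge0 ?pr_ge0.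
Qed.

Lemma energy_le1 (X L : finType) (Y : W -> L) (f : W -> X) : energy Y f <= 1.
Proof.
rewrite -(pr_sum f); apply: ler_sum => x _; rewrite -[leRHS](pr2_suml f Y).
apply: ler_sum => l _; have [->|p0] := eqVneq (pr f x) 0.
  by rewrite invr0 mulr0 pr2_ge0.
rewrite ler_pdivrMr ?lt_def ?p0 ?pr_ge0 // expr2 ler_wpM2l ?pr2_ge0 //.
exact: pr2_le.
Qed.

Lemma energy_comp (X C L : finType) (f : W -> X) (Y : W -> L) (h : X -> C) (l0 : L) :
  energy Y (fun w => h (f w)) <= energy Y f.
Proof.
rewrite -subr_ge0 (energyB _ _ _ l0).
by do 2!apply: sumr_ge0 => ? _; rewrite divr_ge0 ?sqr_ge0 ?pr_ge0.
Qed.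

Lemma energy_mono (X C L : finType) (f : W -> X) (g : W -> C) (Y : W -> L) :
  (forall w w', f w = f w' -> g w = g w') -> energy Y g <= energy Y f.
Proof.
move=> fg; case: (pickP (@predT W)) => [w0 _|W0]; last first.
  rewrite /energy big1 ?energy_ge0 // => c _; rewrite big1 // => l _.
  by rewrite /pr2 big_pred0 ?expr0n ?mul0r // => w; have := W0 w.
(* [f] determines [g], so any preimage of [x] may be used; [w0] only serves values that [f] never
   takes. *)
pose h x := g (odflt w0 [pick w | f w == x]).
rewrite (_ : energy Y g = energy Y (fun w => h (f w))); last first.
  have E : g =1 (fun w => h (f w)).
    move=> w; rewrite /h; case: pickP => [w' /eqP /fg //|/(_ w)]; by rewrite eqxx.
  rewrite /energy; apply: eq_bigr => c _; apply: eq_bigr => l _.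
  by congr (_ ^+ 2 / _); apply: eq_bigl => w; rewrite E.
exact: energy_comp (Y w0).
Qed.

(* The L1 distance between the two conditional laws of [Y] is controlled by the
   energy increment through [|d| <= d^2 / (2 eta p) + eta p / 2]. *)
Lemma replace_label (X C L : finType) (f : W -> X) (Y : W -> L) (h : X -> C)
    (l0 : L) (A : {set L}) (N : nat) (K : X -> L -> R) (d : R) :
  (forall w, Y w \in A) -> (#|A| <= N)%N -> (0 < N)%N -> 0 < d ->
  (forall x l, 0 <= K x l <= 1) ->
  energy Y f - energy Y (fun w => h (f w)) <= d ^+ 2 / N%:R ->
  \sum_w P w * K (f w) (Y w) <=
  \sum_w P w * (\sum_l condp Y (fun w => h (f w)) l0 (h (f w)) l * K (f w) l) + d.
Proof.
move=> YA AN N0 d0 K01; set q := condp Y _ l0; rewrite (energyB _ _ _ l0) -/q => He.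
rewrite (expect_pr f (fun x => \sum_l q (h x) l * K x l)) expect_pr2.
rewrite -lerBlDl -sumrB.
pose D x l := pr2 f Y x l - pr f x * q (h x) l.
(* With this [eta] the quadratic term costs (d^2 / N) / (2 eta) = d / 2, and the linear term, summed
   over at most [N] labels, costs N eta / 2 = d / 2. *)
pose eta := d / N%:R; pose e2 := 2 * eta; pose h2 := eta / 2.
have N0' : 0 < N%:R :> R by rewrite ltr0n.
have eta0 : 0 < eta by rewrite divr_gt0.
have e0 : 0 < e2 by rewrite mulr_gt0.
have h0 : 0 < h2 by rewrite divr_gt0.
apply: (@le_trans _ _ (\sum_x \sum_(l in A)
   (D x l ^+ 2 / pr f x / e2 + h2 * pr f x))).
  apply: ler_sum => x _; rewrite mulr_sumr -sumrB [leRHS]big_mkcond /=.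
  apply: ler_sum => l _.
  have -> : pr2 f Y x l * K x l - pr f x * (q (h x) l * K x l) = D x l * K x l.
    by rewrite /D; ring.
  have /andP[k0 k1] := K01 x l; case: ifP => lA; last first.
    have -> : D x l = - (pr f x * q (h x) l).
      rewrite /D /pr2 big_pred0 ?sub0r // => w; apply/negP => /andP[_ /eqP wl].
      by move: (YA w); rewrite wl lA.
    by rewrite mulNr oppr_le0 !mulr_ge0 ?pr_ge0 ?condp_ge0.
  have [p0|p0] := eqVneq (pr f x) 0.
    have -> : D x l = 0.
      rewrite /D p0 mul0r subr0; apply/eqP; rewrite eq_le pr2_ge0 andbT -p0.
      exact: pr2_le.
    by rewrite mul0r expr0n !mul0r p0 mulr0 addr0.
  have p0' : 0 < pr f x by rewrite lt_def p0 pr_ge0.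
  apply: (@le_trans _ _ `|D x l|).
    by apply: le_trans (ler_norm _) _; rewrite normrM ler_piMr // ger0_norm.
  rewrite -[D x l ^+ 2]real_normK ?num_real //.
  set a := `|D x l|; set p := pr f x in p0 p0' *.
  rewrite -subr_ge0.
  have -> : a ^+ 2 / p / e2 + h2 * p - a = (a - eta * p) ^+ 2 / (e2 * p).
    by rewrite /h2 /e2; field; rewrite p0 gt_eqF.
  apply: divr_ge0; first exact: sqr_ge0.
  by apply/ltW/mulr_gt0.
have -> : d = d ^+ 2 / N%:R / e2 + h2 * N%:R.
  by rewrite /e2 /h2 /eta; field; rewrite !gt_eqF.
under eq_bigr do rewrite big_split /= sumr_const.
rewrite big_split /= lerD //.
  apply: le_trans (_ : (\sum_x \sum_l D x l ^+ 2 / pr f x) / e2 <= _).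
    rewrite mulr_suml ler_sum // => x _; rewrite mulr_suml [leLHS]big_mkcond /=.
    apply: ler_sum => l _; case: ifP => // _.
    by rewrite !divr_ge0 ?sqr_ge0 ?pr_ge0 // ltW.
  by rewrite ler_pM2r // invr_gt0.
by rewrite sumrMnl -mulr_sumr pr_sum mulr1 -[h2 *+ _]mulr_natr ler_pM2l ?ler_nat.
Qed.

End Energy.

Section ProductWeights.
Variable R : realFieldType.

Lemma prod_weight_sum (I L : finType) (p : I -> L -> R) :
  (forall i, \sum_l p i l = 1) ->
  \sum_(Th : {ffun I -> L}) \prod_i p i (Th i) = 1.
Proof. by move=> p1; rewrite -bigA_distr_bigA big1. Qed.

(* Swapping [Th b] with the independent copy [l] preserves the weight. *)
Lemma prod_weight_resample (I L : finType) (p : I -> L -> R) (b : I)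
    (K : {ffun I -> L} -> L -> R) :
  (forall i, \sum_l p i l = 1) ->
  (forall (Th Th' : {ffun I -> L}) l, (forall i, i != b -> Th i = Th' i) -> K Th l = K Th' l) ->
  \sum_(Th : {ffun I -> L}) (\prod_i p i (Th i)) * K Th (Th b) =
  \sum_l p b l * \sum_(Th : {ffun I -> L}) (\prod_i p i (Th i)) * K Th l.
Proof.
move=> p1 Kb.
transitivity (\sum_(u : {ffun I -> L} * L)
    (\prod_i p i (u.1 i)) * p b u.2 * K u.1 (u.1 b)).
  rewrite -(pair_bigA _ (fun (Th : {ffun I -> L}) l => (\prod_i p i (Th i)) * p b l * K Th (Th b))) /=.
  apply: eq_bigr => Th _; rewrite -mulr_suml; congr (_ * _).
  by rewrite -mulr_sumr p1 mulr1.
pose sw (u : {ffun I -> L} * L) := ([ffun i => if i == b then u.2 else u.1 i], u.1 b).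
have swK : involutive sw.
  case=> Th l; rewrite /sw /= ffunE eqxx; congr (_, _); apply/ffunP => i.
  by rewrite !ffunE; case: eqP => [->|].
rewrite (reindex_inj (inv_inj swK)) /=.
under [RHS]eq_bigr do rewrite mulr_sumr.
rewrite exchange_big pair_bigA /=; apply: eq_bigr => -[Th l] _ /=.
rewrite ffunE eqxx mulrCA mulrA; congr (_ * _); last first.
  by apply: Kb => i /negPf ib; rewrite ffunE ib.
rewrite (bigD1 b) //= [in RHS](bigD1 b) //= ffunE eqxx.
rewrite (eq_bigr (fun i => p i (Th i))); first by ring.
by move=> i /negPf ib; rewrite ffunE ib.
Qed.

(** Marginals of a product weight: coordinates outside the image of [i0] sum to 1, and injectivity
    keeps the observed coordinates independent. *)
Lemma prod_weight_inj (I J L : finType) (i0 : I -> J) (p : J -> L -> R)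
    (K : {ffun I -> L} -> R) :
  injective i0 -> (forall j, \sum_l p j l = 1) ->
  \sum_(Th : {ffun J -> L}) (\prod_j p j (Th j)) * K [ffun i => Th (i0 i)] =
  \sum_(Th : {ffun I -> L}) (\prod_i p (i0 i) (Th i)) * K Th.
Proof.
move=> i0I p1.
rewrite (partition_big (fun Th : {ffun J -> L} => [ffun i => Th (i0 i)]) predT) //=.
apply: eq_bigr => S _.
under eq_bigr => Th /eqP -> do idtac.
rewrite -mulr_suml; congr (_ * _).
(* The constraint that [Th] restricts to [S] moves into the factors, which vanish at wrong labels;
   the sum over [Th] then factorizes again. *)
pose F j l : R := if [pick i | i0 i == j] is Some i then p j l *+ (l == S i) else p j l.
transitivity (\sum_(Th : {ffun J -> L}) \prod_j F j (Th j)).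
  rewrite big_mkcond; apply: eq_bigr => Th _; case: eqP => [TS|ne].
    apply: eq_bigr => j _; rewrite /F -TS; case: pickP => // i /eqP <-.
    by rewrite ffunE eqxx.
  have [i iP] : exists i, Th (i0 i) != S i.
    apply/existsP; apply: contraT; rewrite negb_exists => /forallP h.
    by case: ne; apply/ffunP => i; rewrite ffunE; apply/eqP; have := h i; rewrite negbK.
  rewrite (bigD1 (i0 i)) //= {1}/F; case: pickP => [i' /eqP /i0I ->|/(_ i)].
    by rewrite (negPf iP) mulr0n mul0r.
  by rewrite eqxx.
rewrite -bigA_distr_bigA /=.
transitivity (\prod_j \prod_(i | i0 i == j) p j (S i)).
  apply: eq_bigr => j _; rewrite /F; case: pickP => [i /eqP <-|h].
    rewrite (big_pred1 i) => [|i']; last by rewrite /= inj_eq.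
    by rewrite (bigD1 (S i)) //= eqxx mulr1n big1 ?addr0 // => l /negPf ->.
  by rewrite p1 big_pred0.
rewrite (exchange_big_dep predT) //=; apply: eq_bigr => i _.
by rewrite (big_pred1 (i0 i)) // => j; rewrite eq_sym.
Qed.

End ProductWeights.

(** * Choice of the core sizes *)

(** A weight-preserving injection of the finite type [W] into itself is a bijection and leaves joint
    laws unchanged. Exchangeability enters the energy estimates here. *)
Lemma energy_reindex (R : realFieldType) (W X L : finType) (P : W -> R)
    (a : W -> W) (Y : W -> L) (f : W -> X) :
  injective a -> (forall w, P (a w) = P w) ->
  energy P (fun w => Y (a w)) (fun w => f (a w)) = energy P Y f.
Proof.
move=> aI Pa; apply: eq_bigr => x _; apply: eq_bigr => l _.
rewrite /pr /pr2 [in RHS](reindex_inj aI) [X in _ = _ / X](reindex_inj aI) /=.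
by congr (_ ^+ 2 / _); apply: eq_bigr => w _; rewrite Pa.
Qed.

Lemma eq_energy (R : realFieldType) (W X L : finType) (P : W -> R)
    (Y Y' : W -> L) (f f' : W -> X) :
  Y =1 Y' -> f =1 f' -> energy P Y f = energy P Y' f'.
Proof.
move=> YY ff; apply: eq_bigr => x _; apply: eq_bigr => l _.
by congr (_ ^+ 2 / _); apply: eq_bigl => w; rewrite ?YY ff.
Qed.

(** * Random maps, cores and labels *)

Section Sampling.
Variables (R : realFieldType) (T : finType) (M n : nat).
Local Notation V := (T * 'I_M.+1)%type.
Local Notation L := {set {set V}}.
Local Notation W := ({ffun V -> 'I_n} * {perm V})%type.
Variable Y : {ffun V -> 'I_n} -> {set {set V}}.

(** The random permutation [w.2] makes the pair ([vmap], [vgraph]) exchangeable under permutations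
    of [V], however [Y] is chosen; [act] realizes these permutations on the sample space. *)
Definition vmap (w : W) : {ffun V -> 'I_n} := [ffun v => w.1 (w.2 v)].
Definition vgraph (w : W) : {set {set V}} := [set e : {set V} | w.2 @: e \in Y w.1].
Definition act (r : {perm V}) (w : W) : W := (w.1, (r * w.2)%g).

(* Block 0 of [V] is a copy of [T]; the core of scale [m] consists of blocks
   1, ..., m.  The map is observed on the core of scale [m 0], and the labels of the
   [j]-subsets of [T] involve the core of scale [m j.+1]. *)
Definition blocks (m : nat) : {set V} := [set v : V | 0 < v.2 <= m]%N.
Definition emb (B : {set T}) : {set V} := [set (x, ord0) | x in B].
Definition lab (m : nat -> nat) (B : {set T}) (y : {set {set V}}) : L :=
  [set Q : {set V} | (Q \subset blocks (m #|B|.+1)) && (emb B :|: Q \in y)].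
Definition res0 (f : {ffun V -> 'I_n}) : {ffun T -> 'I_n} := [ffun x => f (x, ord0)].
(** Hidden coordinates are overwritten by the constant [None] or [set0], so that equality of two
    observations means agreement on the visible ones, as [resSP] and [ctxP] state. *)
Definition resS (m : nat -> nat) (f : {ffun V -> 'I_n}) : {ffun V -> option 'I_n} :=
  [ffun v => if v \in blocks (m 0%N) then Some (f v) else None].
Definition trunc (p : pred {set T}) (lam : {set T} -> L) : {ffun {set T} -> L} :=
  [ffun B => if p B then lam B else set0].
Definition ctx (B : {set T}) (g : {ffun T -> 'I_n}) (s : {ffun V -> option 'I_n})
    (lam : {ffun {set T} -> L}) :
    {ffun T -> option 'I_n} * {ffun V -> option 'I_n} * {ffun {set T} -> L} :=
  ([ffun x => if x \in B then Some (g x) else None], s,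
   trunc (fun B' => B' \proper B) lam).

(** All that a test of the labels up to level |A| can see besides the label of [A] itself;
    [ctx_of A] keeps only the part that lives on [A] and the core. *)
Definition full (m : nat -> nat) (A : {set T}) (w : W) :
    {ffun T -> 'I_n} * {ffun V -> option 'I_n} * {ffun {set T} -> L} :=
  (res0 (vmap w), resS m (vmap w),
   trunc (fun B => (#|B| <= #|A|)%N && (B != A)) (fun B => lab m B (vgraph w))).
Definition ctx_of (A : {set T})
    (x : {ffun T -> 'I_n} * {ffun V -> option 'I_n} * {ffun {set T} -> L}) :=
  ctx A x.1.1 x.1.2 x.2.
Definition wlab (m : nat -> nat) (A : {set T}) (w : W) : L := lab m A (vgraph w).
Definition unif (w : W) : R := #|{: W}|%:R^-1.

(** By [energyB], a squared measure of how far the label of [A] is from being independent of the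
    rest of [full], conditionally on its own context. *)
Definition gain (m : nat -> nat) (A : {set T}) : R :=
  energy unif (wlab m A) (full m A) -
  energy unif (wlab m A) (fun w => ctx_of A (full m A w)).

Lemma vmap_act r w v : vmap (act r w) v = vmap w (r v).
Proof. by rewrite !ffunE permM. Qed.

Lemma vgraph_act r w e : (e \in vgraph (act r w)) = (r @: e \in vgraph w).
Proof.
rewrite !inE /=; suff -> : (r * w.2)%g @: e = w.2 @: (r @: e) by [].
by rewrite -imset_comp; apply: eq_imset => v; rewrite /= permM.
Qed.

Lemma in_lab m (B : {set T}) y Q :
  (Q \in lab m B y) = (Q \subset blocks (m #|B|.+1)) && (emb B :|: Q \in y).
Proof. by rewrite inE. Qed.

Lemma act_inj r : injective (act r).
Proof. by move=> [f p] [f' p'] [-> /mulgI ->]. Qed.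

Lemma unif_ge0 w : 0 <= unif w.
Proof. by rewrite /unif invr_ge0 ler0n. Qed.

Lemma ctxP B g s lam g' s' lam' :
  ctx B g s lam = ctx B g' s' lam' <->
  [/\ {in B, g =1 g'}, s = s' & forall B' : {set T}, B' \proper B -> lam B' = lam' B'].
Proof.
split=> [[/ffunP gg -> /ffunP ll]|[gg -> ll]].
  split=> // [x xB|B' B'B]; first by have := gg x; rewrite !ffunE xB => -[].
  by have := ll B'; rewrite !ffunE B'B.
congr (_, _, _); apply/ffunP => x; rewrite !ffunE; case: ifP => // h.
  by rewrite gg.
by rewrite ll.
Qed.

Lemma resSP m f f' : resS m f = resS m f' <-> {in blocks (m 0%N), f =1 f'}.
Proof.
split=> [/ffunP h v vb|h].
  by have := h v; rewrite !ffunE vb => -[].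
by apply/ffunP => v; rewrite !ffunE; case: ifP => // /h ->.
Qed.

Lemma blocksS m m' : (m <= m')%N -> blocks m \subset blocks m'.
Proof.
by move=> mm'; apply/subsetP => v; rewrite !inE => /andP[-> /leq_trans ->].
Qed.

Lemma card_blocks m : (#|blocks m| <= #|T| * m)%N.
Proof.
have sub : blocks m \subset setX [set: T] [set (inord i.+1 : 'I_M.+1) | i : 'I_m in 'I_m].
  apply/subsetP => -[x c]; rewrite !inE /= => /andP[c0 cm].
  apply/imsetP; have cm' : (c.-1 < m)%N by rewrite prednK.
  by exists (Ordinal cm') => //; rewrite /= prednK // inord_val.
apply: leq_trans (subset_leq_card sub) _; rewrite cardsX cardsT leq_mul2l.
by apply/orP; right; rewrite -[leqRHS]card_ord; apply: leq_imset_card.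
Qed.

(** Doubly exponential because a label is a family of subsets of a core with at most |T| m
    vertices. *)
Definition nlab (m : nat) : nat := 2 ^ (2 ^ (#|T| * m)).

Lemma lab_card m (A : {set T}) : (#|powerset (powerset (blocks (m #|A|.+1)))| <= nlab (m #|A|.+1))%N.
Proof. by rewrite !card_powerset !leq_exp2l ?card_blocks. Qed.

Lemma wlab_in m (A : {set T}) w : wlab m A w \in powerset (powerset (blocks (m #|A|.+1))).
Proof.
by rewrite inE; apply/subsetP => Q; rewrite !inE => /andP[].
Qed.


Definition swapf (A : {set T}) (b : 'I_M.+1) (v : V) : V :=
  if v.1 \in A then v else (v.1, tperm ord0 b v.2).

Lemma swapf_inv A b : involutive (swapf A b).
Proof.
by case=> x c; rewrite /swapf /=; case xA: (x \in A); rewrite /= xA // tpermK.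
Qed.

Definition swap (A : {set T}) (b : 'I_M.+1) : {perm V} :=
  perm (inv_inj (@swapf_inv A b)).

Lemma swapE A b v : swap A b v = swapf A b v.
Proof. by rewrite permE. Qed.

Lemma swap_fix A (b : 'I_M.+1) m v : (m < b)%N -> v \in blocks m -> swap A b v = v.
Proof.
case: v => x c; rewrite inE swapE /swapf /= => mb /andP[c0 cm].
case: ifP => // _; rewrite tpermD //; apply/eqP => cE.
  by rewrite -cE in c0.
by move: mb; rewrite cE ltnNge cm.
Qed.

Lemma swap_fixS A (b : 'I_M.+1) m (Q : {set V}) :
  (m < b)%N -> Q \subset blocks m -> swap A b @: Q = Q.
Proof.
move=> mb /subsetP Qm; rewrite -[RHS]imset_id; apply: eq_in_imset => v /Qm.
exact: swap_fix.
Qed.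

(* Exchanging the part of [T] outside [A] with an unused block turns everything
   known about [T] into information carried by the larger blocks of [m']. *)
Lemma energy_step (b : nat) (m m' : nat -> nat) (A : {set T}) :
  (forall i, m i <= b)%N -> (b < M)%N -> (forall i, (i <= #|A|)%N -> (b < m' i)%N) ->
  m' #|A|.+1 = m #|A|.+1 ->
  energy unif (wlab m A) (full m A) <=
  energy unif (wlab m' A) (fun w => ctx_of A (full m' A w)).
Proof.
(* Block [b + 1] lies beyond every core of [m] but inside the cores of [m'] of index at most |A|. *)
move=> mb bM bm' mA; pose c : 'I_M.+1 := inord b.+1.
have cE : c = b.+1 :> nat by rewrite inordK.
have lt_c i : (m i < c)%N by rewrite cE ltnS.
pose s := swap A c.
rewrite -(energy_reindex _ _ (@act_inj s)) //.
rewrite (@eq_energy _ _ _ _ _ _ (wlab m' A) _ (fun w => full m A (act s w))) //.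
  apply: energy_mono => [|w w']; first exact: unif_ge0.
  rewrite /ctx_of /full /= => /ctxP[] fA /resSP fS lA.
  have f_s v : v \in [set (x, ord0) | x in [set: T]] :|: blocks (m 0%N) ->
      vmap w (s v) = vmap w' (s v).
    case/setUP => [/imsetP[x _ ->]|vb]; last first.
      rewrite /s (swap_fix A (lt_c 0%N) vb); apply: fS; apply: subsetP vb; apply: blocksS.
      by apply: leq_trans (mb _) _; apply: ltnW; apply: bm'.
    rewrite /s swapE /swapf /=; case: ifP => xA.
      by have := fA _ xA; rewrite !ffunE.
    by apply: fS; rewrite inE /= tpermL cE /=; apply: bm'.
  congr (_, _, _).
  - by apply/ffunP => x; rewrite ffunE [RHS]ffunE !vmap_act f_s // inE imset_f.
  - by apply/resSP => v vb; rewrite !vmap_act f_s // inE vb orbT.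
  apply/ffunP => B; rewrite !ffunE; case: ifP => // /andP[BA BnA].
  (* A set [B] other than [A] with at most |A| elements cannot contain [A]. *)
  have pBA : B :&: A \proper A.
    rewrite properE subsetIr /= subsetI subxx andbT; apply: contra BnA => AB.
    by rewrite eq_sym eqEcard AB.
  have lt_BA := proper_card pBA.
  apply/setP => Q; rewrite !in_lab; case: (boolP (Q \subset _)) => //= Qm.
  (* The swap moves the part of [B] outside [A] into block [c], so the question about [B] and [Q] is
     answered by the label of [B :&: A] with the larger core. *)
  have sE : s @: (emb B :|: Q) =
      emb (B :&: A) :|: (Q :|: [set (x, c) | x in B :\: A]).
    rewrite imsetU /s (swap_fixS A (lt_c _) Qm) [RHS]setUCA setUC; congr (_ :|: _).
    rewrite -imset_comp -{1}(setID B A) imsetU; congr (_ :|: _).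
      by apply: eq_in_imset => x; rewrite inE => /andP[_ xA]; rewrite /= swapE /swapf /= xA.
    apply: eq_in_imset => x; rewrite inE => /andP[xA _].
    by rewrite /= swapE /swapf /= (negPf xA) tpermL.
  rewrite !vgraph_act sE.
  have Qm' : Q :|: [set (x, c) | x in B :\: A] \subset blocks (m' #|B :&: A|.+1).
    have bm1 : (b < m' #|B :&: A|.+1)%N by apply: bm'.
    apply/subsetP => v /setUP[/(subsetP Qm)|/imsetP[x _ ->]]; last first.
      by rewrite inE /= cE.
    apply: subsetP; apply: blocksS; apply: leq_trans (mb _) _; exact: ltnW.
  have BAnA : B :&: A != A by apply: contraL pBA => /eqP ->; rewrite properxx.
  have := lA _ pBA; rewrite !ffunE (ltnW lt_BA) BAnA /=.
  by move=> /setP/(_ (Q :|: [set (x, c) | x in B :\: A])); rewrite !in_lab Qm'.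
move=> w; apply/setP => Q; rewrite !in_lab mA; case: (boolP (Q \subset _)) => //= Qm.
rewrite -[in RHS](_ : s @: (emb A :|: Q) = emb A :|: Q) ?vgraph_act //.
rewrite imsetU /s (swap_fixS A (lt_c _) Qm); congr (_ :|: _); rewrite -imset_comp.
by apply: eq_in_imset => x xA; rewrite /= swapE /swapf /= xA.
Qed.

End Sampling.


(** * Stable core sizes by energy increment *)

Section Stability.
Variables (R : archiRealFieldType) (T : finType) (d : R).
Hypothesis d_gt0 : 0 < d.

Definition stable M n (Y : {ffun T * 'I_M.+1 -> 'I_n} -> {set {set T * 'I_M.+1}})
    (m : nat -> nat) (A : {set T}) : Prop :=
  gain R Y m A <= d ^+ 2 / (nlab T (m #|A|.+1))%:R.

(** Scales of index at least [j] are prescribed by [c]; the lower ones lie between [L] and [B]. Sets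
    with fewer than [j] elements involve no scale of index above [j], which permits induction on
    [j]. *)
Definition stable_scales (j B : nat) (c : nat -> nat) (L M n : nat)
    (Y : {ffun T * 'I_M.+1 -> 'I_n} -> {set {set T * 'I_M.+1}}) (m : nat -> nat) :=
  [/\ (forall i, (j <= i)%N -> m i = c i), (forall i, (i < j)%N -> (L <= m i)%N),
      (forall i, (m i <= B)%N) &
      (forall A : {set T}, (#|A| < j)%N -> stable Y m A)].

Definition ctx_energy M n (Y : {ffun T * 'I_M.+1 -> 'I_n} -> {set {set T * 'I_M.+1}})
    (j : nat) (m : nat -> nat) : R :=
  \sum_(A : {set T} | #|A| == j)
     energy (@unif R T M n) (wlab Y m A) (fun w => ctx_of A (full Y m A w)).

Lemma ctx_energy_ge0 M n Y j m : 0 <= @ctx_energy M n Y j m.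
Proof. by apply: sumr_ge0 => A _; apply: energy_ge0 => w; apply: unif_ge0. Qed.

Lemma unif_sum M n : (0 < n)%N ->
  \sum_(w : {ffun T * 'I_M.+1 -> 'I_n} * {perm (T * 'I_M.+1)}) unif R w = 1.
Proof.
case: n => // n _; rewrite /unif sumr_const -[LHS]mulr_natr mulVf // pnatr_eq0 -lt0n.
by apply/card_gt0P; exists ([ffun=> ord0], 1%g).
Qed.

Lemma ctx_energy_le M n Y j m : (0 < n)%N -> @ctx_energy M n Y j m <= (2 ^ #|T|)%:R.
Proof.
move=> n0; apply: (@le_trans _ _ (\sum_(A : {set T}) 1)).
  rewrite [leLHS]big_mkcond; apply: ler_sum => A _; case: ifP => _; last exact: ler01.
  by apply: energy_le1; [exact: unif_ge0 | exact: unif_sum].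
by rewrite sumr_const -(cardsT T) -card_powerset powersetT cardsT.
Qed.

(** An unstable [j]-set adds its gain by [energy_step], and the other [j]-sets lose nothing because
    [full] refines its own context. *)
Lemma ctx_energy_step (M n b j : nat) Y (m m' : nat -> nat) :
  (forall i, (m i <= b)%N) -> (b < M)%N -> (forall i, (i <= j)%N -> (b < m' i)%N) ->
  m' j.+1 = m j.+1 ->
  ~ (forall A : {set T}, #|A| = j -> stable Y m A) ->
  @ctx_energy M n Y j m + d ^+ 2 / (nlab T (m j.+1))%:R <= ctx_energy Y j m'.
Proof.
move=> mb bM bm' mj nst.
have [A Aj nA] : exists2 A : {set T}, #|A| == j &
    d ^+ 2 / (nlab T (m j.+1))%:R < gain R Y m A.
  apply/exists_inP; apply: contraT; rewrite negb_exists_in => /forall_inP h.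
  case: nst => A /eqP Aj; have := h A Aj; rewrite -leNgt.
  by rewrite /stable (eqP Aj).
have step (B : {set T}) : #|B| == j ->
    energy (@unif R T M n) (wlab Y m B) (full Y m B) <=
    energy (@unif R T M n) (wlab Y m' B) (fun w => ctx_of B (full Y m' B w)).
  by move=> /eqP Bj; apply: (energy_step R Y mb bM); rewrite Bj.
rewrite /ctx_energy (bigD1 A) //= [leRHS](bigD1 A) //= addrAC lerD //.
  by apply: le_trans (step A Aj); rewrite -lerBrDl; apply: ltW.
apply: ler_sum => B /andP[Bj _]; apply: le_trans (step B Bj).
by apply: energy_comp => //; [exact: unif_ge0 | exact: set0].
Qed.

(** Energy increment at level [j], with the lower levels restabilized by induction in every round.
    The bound [B] is chosen before [M], [n] and [Y]. *)
Lemma stable_scales_exist j c L : (forall i, (c i <= L)%N) ->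
  exists2 B, (L <= B)%N & forall M n Y, (B <= M)%N -> (0 < n)%N ->
    exists m, @stable_scales j B c L M n Y m.
Proof.
elim: j c L => [|j IH] c L cL.
  by exists L => // M n Y _ _; exists c; split=> // A.
(* The scale [c j.+1] stays fixed through all rounds, so every round gains the same [e]. *)
pose e := d ^+ 2 / (nlab T (c j.+1))%:R.
have e0 : 0 < e by rewrite divr_gt0 ?exprn_gt0 // ltr0n expn_gt0.
(* The induction hypothesis is used with the scale of index [j] raised to [l]; it and all lower
   scales are then at least [l]. *)
pose cj l i := if i == j then l else c i.
have cjL l : (L <= l)%N -> forall i, (cj l i <= l)%N.
  by move=> Ll i; rewrite /cj; case: eqP => // _; apply: leq_trans Ll.
have up l B M n Y m : (L <= l)%N -> (B <= M)%N ->
    @stable_scales j B (cj l) l M n Y m ->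
    [/\ (forall i, (j < i)%N -> m i = c i) & forall i, (i <= j)%N -> (l <= m i)%N].
  move=> Ll BM [mc lm _ _]; split=> i ij.
    by rewrite mc ?(ltnW ij) // /cj gtn_eqF.
  move: ij; rewrite leq_eqVlt => /orP[/eqP ->|/lm //].
  by rewrite mc // /cj eqxx.
(* After [K] rounds either stable scales are found or the energy at level [j] is at least
   [e *+ K]. *)
have loop K : exists2 B, (L <= B)%N & forall M n Y, (B <= M)%N -> (0 < n)%N ->
    (exists m, @stable_scales j.+1 B c L M n Y m) \/
    exists m, [/\ (forall i, (j < i)%N -> m i = c i),
      (forall i, (i <= j)%N -> (L <= m i)%N), (forall i, (m i <= B)%N),
      (forall A : {set T}, (#|A| < j)%N -> stable Y m A) &
      e *+ K <= ctx_energy Y j m].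
  elim: K => [|K [B LB IHK]].
    have [B LB HB] := IH (cj L) L (cjL L (leqnn L)); exists B => // M n Y BM n0.
    have [m mP] := HB M n Y BM n0; right; exists m.
    have [mc Lm] := up _ _ _ _ _ _ (leqnn L) BM mP; case: mP => _ _ mB mst.
    by split=> //; rewrite mulr0n ctx_energy_ge0.
  have LB1 : (L <= B.+1)%N by apply: leq_trans LB _.
  have [B' BB' HB'] := IH (cj B.+1) B.+1 (cjL _ LB1).
  have leBB' : (B <= B')%N by apply: leq_trans BB'.
  exists B' => [|M n Y B'M n0]; first exact: leq_trans LB _.
  have BM : (B <= M)%N by apply: leq_trans B'M.
  have leB' (m : nat -> nat) : (forall i, (m i <= B)%N) -> forall i, (m i <= B')%N.
    by move=> h i; apply: leq_trans (h i) _.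
  have [[m [m1 m2 m3 m4]]|[m [m1 m2 m3 m4 m5]]] := IHK M n Y BM n0.
    by left; exists m; split=> //; apply: leB'.
  have [m' m'P] := HB' M n Y B'M n0.
  have [m'c Lm'] := up _ _ _ _ _ _ LB1 B'M m'P; case: m'P => _ _ m'B m'st.
  (* If [m] is stable on the [j]-sets it already works. Otherwise the scales [m'], which up to index
     [j] exceed all those of [m], gain [e] in energy. *)
  have [st|nst] := boolP [forall A : {set T}, (#|A| == j) ==>
      (gain R Y m A <= d ^+ 2 / (nlab T (m #|A|.+1))%:R)].
    left; exists m; split=> // [|A]; first exact: leB'.
    rewrite ltnS leq_eqVlt => /orP[Aj|/m4 //].
    by move/forallP: st => /(_ A); rewrite Aj.
  right; exists m'; split=> // [i ij|].
    by apply: leq_trans (Lm' i ij).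
  rewrite mulrSr; apply: le_trans (@ctx_energy_step M n B j Y m m' _ _ _ _ _) => //.
  - by rewrite lerD // /e m1.
  - exact: leq_trans BB' B'M.
  - by rewrite m1 // m'c.
  - move=> st; case/negP: nst; apply/forallP => A; apply/implyP => /eqP.
    exact: st.
have [K HK] : exists K, (2 ^ #|T|)%:R < e *+ K.
  exists (Num.bound ((2 ^ #|T|)%:R / e)); rewrite -[e *+ _]mulr_natr mulrC -ltr_pdivrMr //.
  by apply: archi_boundP; rewrite divr_ge0 ?ler0n ?ltW.
have [B LB HB] := loop K; exists B => // M n Y BM n0.
have [//|[m [_ _ _ _ h]]] := HB M n Y BM n0.
by have := le_trans h (ctx_energy_le _ _ _ n0); rewrite leNgt HK.
Qed.

End Stability.

(** * Sampling the labels of one level *)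

(** Extend on [D] minus a point [x], then correct the image of [x] by a transposition, which moves
    no other prescribed value. *)
Lemma perm_extend (T : finType) (D : {set T}) (h : T -> T) :
  {in D &, injective h} -> exists r : {perm T}, {in D, r =1 h}.
Proof.
have [N] := ubnP #|D|; elim: N D => // N IH D DN hI.
have [->|[x xD]] := set_0Vmem D; first by exists 1%g => y; rewrite inE.
have [||r rE] := IH (D :\ x).
- by rewrite ltnS (cardsD1 x) xD in DN.
- by move=> y z /setD1P[_ yD] /setD1P[_ zD]; apply: hI.
exists (r * tperm (r x) (h x))%g => y yD; rewrite permM.
have [->|yx] := eqVneq y x; first by rewrite tpermL.
rewrite tpermD; first by rewrite rE // !inE yx.
  by rewrite (inj_eq perm_inj) eq_sym.
rewrite rE ?inE ?yx //; apply: contra yx => /eqP /hI -> //.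
Qed.

Section LevelStep.
Variables (R : archiRealFieldType) (T : finType) (M n : nat).
Local Notation V := (T * 'I_M.+1)%type.
Local Notation L := {set {set V}}.
Local Notation GT := {ffun T -> 'I_n}.
Local Notation ST := {ffun V -> option 'I_n}.
Local Notation LT := {ffun {set T} -> {set {set V}}}.
Local Notation W := ({ffun V -> 'I_n} * {perm V})%type.
Variable Y : {ffun V -> 'I_n} -> {set {set V}}.
Variable m : nat -> nat.
Hypothesis n_gt0 : (0 < n)%N.

(** Vanishing off injective maps matters because lifted labels are indexed by image sets, and only
    an injective [g] gives distinct subsets of [T] distinct images. *)
Definition test (F : GT -> ST -> LT -> R) : Prop :=
  (forall g s l, 0 <= F g s l <= 1) /\
  (forall (g : GT) s l, ~~ injectiveb g -> F g s l = 0).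

Definition low (j : nat) : pred {set T} := fun B => (#|B| < j)%N.

Definition wlow (j : nat) (w : W) : LT := trunc (low j) (fun B => wlab Y m B w).

Definition nuE (j : nat) (F : GT -> ST -> LT -> R) : R :=
  \sum_(w : W) unif R w * F (res0 (vmap w)) (resS m (vmap w)) (wlow j w).

Definition klab (B : {set T}) (x : {ffun T -> option 'I_n} * ST * LT) (l : L) : R :=
  condp (@unif R T M n) (wlab Y m B) (fun w => ctx_of B (full Y m B w)) set0 x l.

(** [Th] carries a label for every set, but only the labels of [j]-sets are read; the other factors
    sum to 1. *)
Definition resample (j : nat) (F : GT -> ST -> LT -> R) (g : GT) (s : ST) (l : LT) : R :=
  \sum_(Th : LT) (\prod_B klab B (ctx B g s l) (Th B)) *
     F g s (trunc (low j.+1) (fun B => if low j B then l B else Th B)).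

Lemma klab_ge0 B x l : 0 <= klab B x l.
Proof. by apply: condp_ge0 => w; apply: unif_ge0. Qed.

Lemma klab_sum B x : \sum_l klab B x l = 1.
Proof. exact: condp_sum. Qed.

Lemma klab_weight_ge0 (x : {set T} -> _) (Th : LT) : 0 <= \prod_B klab B (x B) (Th B).
Proof. by apply: prodr_ge0 => B _; apply: klab_ge0. Qed.

Lemma klab_mean_bound (x : {set T} -> _) (K : LT -> R) :
  (forall Th, 0 <= K Th <= 1) ->
  0 <= \sum_(Th : LT) (\prod_B klab B (x B) (Th B)) * K Th <= 1.
Proof.
move=> K01; apply/andP; split.
  by apply: sumr_ge0 => Th _; case/andP: (K01 Th) => K0 _; rewrite mulr_ge0 ?klab_weight_ge0.
rewrite -[leRHS](@prod_weight_sum R _ _ (fun B l => klab B (x B) l)) => [|B]; last exact: klab_sum.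
apply: ler_sum => Th _; case/andP: (K01 Th) => _ K1.
by rewrite ler_piMr ?klab_weight_ge0.
Qed.

Lemma resample_test j F : test F -> test (resample j F).
Proof.
case=> F01 F0; split=> [g s l|g s l gI]; first by apply: klab_mean_bound.
by rewrite /resample big1 // => Th _; rewrite F0 ?mulr0.
Qed.

(** Interpolates between true and resampled labels: the sets in [u] have been resampled. Empty [u]
    gives [nuE j.+1], and all [j]-sets give [nuE j] of [resample j F]. *)
Definition hybrid (j : nat) (u : seq {set T}) (F : GT -> ST -> LT -> R) : R :=
  \sum_(w : W) unif R w *
    \sum_(Th : LT)
      (\prod_B klab B (ctx B (res0 (vmap w)) (resS m (vmap w)) (wlow j w)) (Th B)) *
      F (res0 (vmap w)) (resS m (vmap w))
        (trunc (low j.+1) (fun B => if B \in u then Th B else wlab Y m B w)).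

Lemma hybrid_nil j F : hybrid j [::] F = nuE j.+1 F.
Proof.
apply: eq_bigr => w _; congr (_ * _).
under eq_bigr => Th _ do rewrite -/(wlow j.+1 w).
rewrite -mulr_suml; set x := fun B => ctx B (res0 (vmap w)) (resS m (vmap w)) (wlow j w).
rewrite (@prod_weight_sum R _ _ (fun B l => klab B (x B) l)) ?mul1r // => B.
exact: klab_sum.
Qed.

(** Apart from the label of [A], the test sees a function of [full Y m A] and independently
    resampled labels, so [replace_label] applies with error [d]. *)
Lemma hybrid_cons j (u : seq {set T}) (A : {set T}) F (d : R) : test F -> 0 < d -> #|A| = j -> A \notin u ->
  gain R Y m A <= d ^+ 2 / (nlab T (m #|A|.+1))%:R ->
  hybrid j u F <= hybrid j (A :: u) F + d.
Proof.
move=> [F01 _] d0 Aj Au; rewrite /gain => gainA.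
pose p (x : GT * ST * LT) B l := klab B (ctx B x.1.1 x.1.2 (trunc (low j) x.2)) l.
pose K (x : GT * ST * LT) l : R := \sum_(Th : LT) (\prod_B p x B (Th B)) *
  F x.1.1 x.1.2 (trunc (low j.+1) (fun B => if B \in u then Th B else
                                           if B == A then l else x.2 B)).
have lowE (w : W) : trunc (low j) (full Y m A w).2 = wlow j w.
  apply/ffunP => B; rewrite !ffunE /low; case: ltnP => // Bj.
  rewrite Aj (ltnW Bj) /=; case: eqP => // BA; by rewrite BA Aj ltnn in Bj.
have K01 x l : 0 <= K x l <= 1 by apply: klab_mean_bound.
have := replace_label (@unif_ge0 R T M n) (unif_sum R T M n_gt0) set0
  (wlab_in Y m A) (lab_card M m A) (expn_gt0 _ _) d0 K01 gainA.
congr (_ <= _ + d).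
  apply: eq_bigr => w _; congr (_ * _); apply: eq_bigr => Th _; congr (_ * _).
    by apply: eq_bigr => B _; rewrite /p lowE.
  congr (F _ _ _); apply/ffunP => B; rewrite !ffunE; case: ifP => // Bj.
  by case: ifP => // _; case: eqP => [->//|_]; rewrite Aj -ltnS (Bj : (#|B| < j.+1)%N).
apply: eq_bigr => w _; congr (_ * _).
have x_ctx : ctx_of A (full Y m A w) =
    ctx A (res0 (vmap w)) (resS m (vmap w)) (trunc (low j) (full Y m A w).2).
  apply/ctxP; split=> // B BA; rewrite [RHS]ffunE /low -Aj.
  by rewrite (proper_card BA).
under eq_bigr => l _ do rewrite -/(klab _ _ _) x_ctx.
(* The independent label [l] becomes the coordinate [A] of [Th], which is not read otherwise because
   [A] is not in [u]. *)
rewrite -(@prod_weight_resample R _ _ (p (full Y m A w)) A (fun Th l =>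
  F (res0 (vmap w)) (resS m (vmap w)) (trunc (low j.+1) (fun B =>
    if B \in u then Th B else if B == A then l else (full Y m A w).2 B)))).
- apply: eq_bigr => Th _; congr (_ * _).
    by apply: eq_bigr => B _; rewrite /p lowE.
  congr (F _ _ _); apply/ffunP => B; rewrite !ffunE inE; case: ifP => // Bj.
  case: eqP => [->|/eqP BA]; first by rewrite (negPf Au).
  by case: ifP => // _; rewrite Aj -ltnS (Bj : (#|B| < j.+1)%N).
- by move=> B; apply: klab_sum.
move=> Th Th' l TT; congr (F _ _ _); apply/ffunP => B; rewrite !ffunE; case: ifP => // _.
by case: ifP => // Bu; apply: TT; apply: contraNneq Au => <-.
Qed.

Lemma nuE_step j F (d : R) : test F -> 0 < d ->
  (forall A : {set T}, #|A| = j -> gain R Y m A <= d ^+ 2 / (nlab T (m #|A|.+1))%:R) ->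
  nuE j.+1 F <= nuE j (resample j F) + (2 ^ #|T|)%:R * d.
Proof.
move=> tF d0 st; pose u := enum [set A : {set T} | #|A| == j].
have hyb v : uniq v -> {subset v <= u} -> hybrid j [::] F <= hybrid j v F + d *+ size v.
  elim: v => [|A v IH] /=; first by rewrite mulr0n addr0.
  case/andP=> Av vU sub; have Aj : #|A| = j.
    by have := sub A (mem_head _ _); rewrite mem_enum inE => /eqP.
  have sub' : {subset v <= u} by move=> B Bv; apply: sub; rewrite inE Bv orbT.
  apply: le_trans (IH vU sub') _; rewrite mulrS addrA lerD2r.
  by apply: hybrid_cons => //; apply: st.
rewrite -hybrid_nil; apply: le_trans (hyb u (enum_uniq _) (fun _ h => h)) _.
apply: lerD; last first.
  rewrite -[d *+ _]mulr_natl ler_wpM2r ?(ltW d0) // ler_nat -cardE.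
  rewrite -(cardsT T) -card_powerset powersetT; exact: subset_leq_card (subsetT _).
rewrite le_eqVlt; apply/orP; left; apply/eqP; apply: eq_bigr => w _.
congr (_ * _); apply: eq_bigr => Th _; congr (_ * F _ _ _).
apply/ffunP => B; rewrite !ffunE mem_enum inE /low; case: ifP => // Bj.
by rewrite ltn_neqAle -ltnS Bj andbT; case: eqP.
Qed.


(** * Labels attached to sets of vertices *)

Definition lam_at (j : nat) (Lm : {set 'I_n} -> L) (g : GT) : LT :=
  trunc (low j) (fun B => Lm (g @: B)).

(** Here the labels come from a random labelling [Lm] of the subsets of the vertex set, drawn
    independently of the uniform map [g]; on [k]-sets it will give a graph on all vertices. *)
Definition lifted (j : nat) (e : R) : Prop :=
  exists (O : finType) (p : O -> R) (s : O -> ST) (Lm : O -> {set 'I_n} -> L),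
  [/\ forall o, 0 <= p o, \sum_o p o = 1 &
    forall F, test F -> nuE j F <=
      \sum_o p o * ((\sum_g F g (s o) (lam_at j (Lm o) g)) / #|{: GT}|%:R) + e].

Definition basef (r : {perm T}) (v : V) : V := if v.2 == ord0 then (r v.1, v.2) else v.

Lemma basef_inj r : injective (basef r).
Proof.
apply: (can_inj (g := basef r^-1)) => -[x c]; rewrite /basef /=.
by case c0: (c == ord0); rewrite /= c0 ?permK.
Qed.

Definition base_perm (r : {perm T}) : {perm V} := perm (@basef_inj r).

Lemma base_perm0 r x : base_perm r (x, ord0) = (r x, ord0).
Proof. by rewrite permE /basef. Qed.

Lemma base_perm_blocks r k v : v \in blocks T M k -> base_perm r v = v.
Proof.
rewrite inE permE /basef => /andP[v0 _]; case: eqP => // E.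
by rewrite E in v0.
Qed.

Lemma wlab_base r (B : {set T}) (w : W) :
  wlab Y m B (act (base_perm r) w) = wlab Y m (r @: B) w.
Proof.
have rB : #|r @: B| = #|B| by rewrite card_imset //; apply: perm_inj.
apply/setP => Q; rewrite !in_lab rB; case: (boolP (Q \subset _)) => //= QS.
suff sE : base_perm r @: (emb M B :|: Q) = emb M (r @: B) :|: Q by rewrite vgraph_act sE.
rewrite imsetU; congr (_ :|: _).
  by rewrite /emb -!imset_comp; apply: eq_in_imset => x _ /=; apply: base_perm0.
rewrite -[RHS]imset_id; apply: eq_in_imset => v vQ.
by apply: base_perm_blocks; apply: (subsetP QS).
Qed.

Lemma ctx_fullP (B : {set T}) (w : W) g s lam :
  ctx_of B (full Y m B w) = ctx B g s lam <->
  [/\ forall x, x \in B -> vmap w (x, ord0) = g x, resS m (vmap w) = s &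
      forall C : {set T}, C \proper B -> wlab Y m C w = lam C].
Proof.
have fE (C : {set T}) : C \proper B -> (full Y m B w).2 C = wlab Y m C w.
  move=> CB; rewrite ffunE (ltnW (proper_card CB)) /=.
  by case: eqP => // CE; rewrite CE properxx in CB.
rewrite ctxP /=; split=> -[gE sE lE].
  split=> // [x xB|C CB]; first by rewrite -gE ?ffunE.
  by rewrite -lE ?fE.
split=> // [x xB|C CB]; first by rewrite ffunE gE.
by rewrite -lE // -fE.
Qed.

(* The conditional law of a label only depends on the image of its index set. *)
Lemma klab_image j (s : ST) Lm (g g' : GT) (B B' : {set T}) l :
  injective g -> injective g' -> g @: B = g' @: B' ->
  klab B (ctx B g s (lam_at j Lm g)) l = klab B' (ctx B' g' s (lam_at j Lm g')) l.
Proof.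
move=> gI gI' gB.
have [h hE] : exists h : T -> T, {in B', forall x, h x \in B /\ g (h x) = g' x}.
  exists (fun x => odflt x [pick y in B | g y == g' x]) => x xB.
  case: pickP => [y /andP[yB /eqP] //|no].
  have /imsetP[y yB gy] : g' x \in g @: B by rewrite gB imset_f.
  by have := no y; rewrite /= yB gy eqxx.
have hI : {in B' &, injective h}.
  move=> x y xB yB hxy; apply: gI'.
  by rewrite -(hE x xB).2 -(hE y yB).2 hxy.
(* The bijection from [B'] to [B] over the common image extends to a permutation of [T]. Its action
   on block 0 fixes the core and carries one context to the other. *)
have [r rE] := perm_extend hI.
have grE : {in B', forall x, g (r x) = g' x}.
  by move=> x xB; rewrite rE // (hE x xB).2.
have grS (C : {set T}) : C \subset B' -> g @: (r @: C) = g' @: C.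
  move=> CB; rewrite -imset_comp; apply: eq_in_imset => x xC /=.
  by apply: grE; apply: (subsetP CB).
have rB : r @: B' = B.
  by apply: (imset_inj gI); rewrite grS.
pose a := @act T M n (base_perm r).
have cE w : (ctx_of B (full Y m B w) == ctx B g s (lam_at j Lm g)) =
    (ctx_of B' (full Y m B' (a w)) == ctx B' g' s (lam_at j Lm g')).
  have sE : resS m (vmap (a w)) = resS m (vmap w).
    by apply/resSP => v vb; rewrite vmap_act (base_perm_blocks _ vb).
  have lamE (C : {set T}) : C \subset B' -> lam_at j Lm g (r @: C) = lam_at j Lm g' C.
    by move=> CB; rewrite !ffunE /low (card_imset _ perm_inj) grS.
  apply/eqP/eqP => /ctx_fullP [gE sE' lE]; apply/ctx_fullP; split.
  - by move=> x xB; rewrite vmap_act base_perm0 gE -?grE // -rB imset_f.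
  - by rewrite sE.
  - move=> C CB; rewrite wlab_base lE ?lamE ?proper_sub // -rB properEcard imsetS ?proper_sub //.
    by rewrite !(card_imset _ perm_inj) proper_card.
  - move=> x; rewrite -rB => /imsetP[y yB ->]; rewrite grE // -gE //.
    by rewrite vmap_act base_perm0.
  - by rewrite -sE.
  - move=> C; have [C1 ->] : exists C1 : {set T}, C = r @: C1.
      exists (r^-1 @: C)%g; rewrite -imset_comp -[LHS]imset_id.
      by apply: eq_in_imset => y _ /=; rewrite permKV.
    rewrite -rB properEcard !(card_imset _ perm_inj) => /andP[sub lt].
    have C1B : C1 \subset B'.
      by apply/subsetP => y /(imset_f r) /(subsetP sub) /imsetP[z zB /perm_inj ->].
    by rewrite lamE // -lE ?properEcard ?C1B // wlab_base.
have lE w : wlab Y m B w = wlab Y m B' (a w) by rewrite /a wlab_base rB.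
have aI := @act_inj T M n (base_perm r).
rewrite /klab /condp.
have -> : pr (@unif R T M n) (fun w => ctx_of B (full Y m B w)) (ctx B g s (lam_at j Lm g)) =
    pr (@unif R T M n) (fun w => ctx_of B' (full Y m B' w)) (ctx B' g' s (lam_at j Lm g')).
  by rewrite /pr [RHS](reindex_inj aI); apply: eq_bigl => w; rewrite cE.
have -> // : pr2 (@unif R T M n) (fun w => ctx_of B (full Y m B w)) (wlab Y m B)
      (ctx B g s (lam_at j Lm g)) l =
    pr2 (@unif R T M n) (fun w => ctx_of B' (full Y m B' w)) (wlab Y m B')
      (ctx B' g' s (lam_at j Lm g')) l.
by rewrite /pr2 [RHS](reindex_inj aI); apply: eq_bigl => w; rewrite cE lE.
Qed.

(** The law of the label of a vertex set, computed through any injective map that reaches it; by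
    [klab_image] the choice is immaterial. Sets reached by no injective map get a point mass. *)
Definition glab (j : nat) (s : ST) (Lm : {set 'I_n} -> L) (A : {set 'I_n}) (l : L) : R :=
  if [pick u : GT * {set T} | injectiveb u.1 && (u.1 @: u.2 == A)] is Some u
  then klab u.2 (ctx u.2 u.1 s (lam_at j Lm u.1)) l else (l == set0)%:R.

Lemma glab_ge0 j s Lm A l : 0 <= glab j s Lm A l.
Proof. by rewrite /glab; case: pickP => *; rewrite ?klab_ge0 ?ler0n. Qed.

Lemma glab_sum j s Lm A : \sum_l glab j s Lm A l = 1.
Proof.
rewrite /glab; case: pickP => *; first exact: klab_sum.
by rewrite (bigD1 set0) //= eqxx big1 ?addr0 // => l /negPf ->.
Qed.

Lemma glabE j s Lm (g : GT) (B : {set T}) l : injective g ->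
  glab j s Lm (g @: B) l = klab B (ctx B g s (lam_at j Lm g)) l.
Proof.
move=> gI; rewrite /glab; case: pickP => [[g' B'] /= /andP[/injectiveP gI' /eqP gB]|].
  exact: klab_image.
by move/(_ (g, B)); rewrite /= eqxx andbT => /injectiveP.
Qed.

(** Draw the labels of [j]-sets of vertices independently from [glab]. An injective [g] sends
    distinct sets to distinct sets, so the labels pulled back along [g] have exactly the law used in
    [resample]. *)
Lemma lifted_step j (e d : R) : 0 < d ->
  (forall A : {set T}, #|A| = j -> gain R Y m A <= d ^+ 2 / (nlab T (m #|A|.+1))%:R) ->
  lifted j e -> lifted j.+1 (e + (2 ^ #|T|)%:R * d).
Proof.
move=> d0 st [O [p [s [Lm [p0 p1 pF]]]]].
pose O' : finType := (O * {ffun {set 'I_n} -> L})%type.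
exists O', (fun o : O * {ffun {set 'I_n} -> L} => p o.1 * (\prod_A glab j (s o.1) (Lm o.1) A (o.2 A))).
exists (fun o : O * {ffun {set 'I_n} -> L} => s o.1).
exists (fun (o : O * {ffun {set 'I_n} -> L}) (A : {set 'I_n}) => if (#|A| < j)%N then Lm o.1 A else o.2 A); split.
- by move=> o; rewrite mulr_ge0 // prodr_ge0 // => A _; apply: glab_ge0.
- rewrite -(pair_bigA _ (fun o (Th : {ffun {set 'I_n} -> L}) =>
    p o * (\prod_A glab j (s o) (Lm o) A (Th A)))) /= -[RHS]p1; apply: eq_bigr => o _.
  by rewrite -mulr_sumr (prod_weight_sum (glab_sum j (s o) (Lm o))) mulr1.
move=> F tF; apply: le_trans (nuE_step tF d0 st) _; rewrite addrA lerD2r.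
apply: le_trans (pF _ (resample_test j tF)) _; rewrite lerD2r.
rewrite -(pair_bigA _ (fun o (Th : {ffun {set 'I_n} -> L}) =>
    p o * (\prod_A glab j (s o) (Lm o) A (Th A)) *
      ((\sum_g F g (s o) (lam_at j.+1 (fun A : {set 'I_n} =>
          if (#|A| < j)%N then Lm o A else Th A) g)) / #|{: GT}|%:R))) /=.
rewrite le_eqVlt; apply/orP; left; apply/eqP; apply: eq_bigr => o _.
under [RHS]eq_bigr => Th _ do rewrite -mulrA.
rewrite -mulr_sumr; congr (_ * _).
under [RHS]eq_bigr => Th _ do rewrite mulrA mulr_sumr.
rewrite -mulr_suml [in RHS]exchange_big; congr (_ / _); apply: eq_bigr => g _.
have [/injectiveP gI|gI] := boolP (injectiveb g); last first.
  rewrite (resample_test j tF).2 // big1 // => Th _; rewrite tF.2 ?mulr0 //.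
have igI : injective (fun B : {set T} => g @: B) by apply: imset_inj.
pose K (Th : LT) := F g (s o) (trunc (low j.+1)
  (fun B => if low j B then lam_at j (Lm o) g B else Th B)).
transitivity (\sum_(Th : LT) (\prod_(B : {set T}) glab j (s o) (Lm o) (g @: B) (Th B)) * K Th).
  by apply: eq_bigr => Th _; congr (_ * _); apply: eq_bigr => B _; rewrite glabE.
(* Labels of vertex sets outside the image of [g] are summed out. *)
rewrite -(prod_weight_inj K igI (glab_sum j (s o) (Lm o))).
apply: eq_bigr => Th _; congr (_ * F _ _ _); apply/ffunP => B; rewrite !ffunE.
by rewrite /low card_imset //; case: (#|B| < j.+1)%N => //; case: (#|B| < j)%N.
Qed.

End LevelStep.

(** * Lifting *)

Section Lifting.
Variables (R : archiRealFieldType) (T : finType).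

Lemma unif_vmap M n (K : {ffun T * 'I_M.+1 -> 'I_n} -> R) :
  \sum_w unif R w * K (@vmap T M n w) = (\sum_f K f) / #|{ffun T * 'I_M.+1 -> 'I_n}|%:R.
Proof.
rewrite -(pair_bigA _ (fun f p => unif R (f, p) * K (vmap (f, p)))) exchange_big /=.
have permE (p : {perm T * 'I_M.+1}) :
    \sum_f unif R (f, p) * K (vmap (f, p)) =
    (\sum_f K f) / #|{: {ffun T * 'I_M.+1 -> 'I_n} * {perm T * 'I_M.+1}}|%:R.
  pose h (f : {ffun T * 'I_M.+1 -> 'I_n}) := [ffun v => f ((p^-1)%g v)].
  have hI : injective h.
    by move=> f f' /ffunP E; apply/ffunP => v; have := E (p v); rewrite !ffunE permK.
  rewrite (reindex_inj hI) mulrC mulr_sumr; apply: eq_bigr => f _.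
  congr (_ * K _); apply/ffunP => v; by rewrite !ffunE permK.
rewrite (eq_bigr _ (fun p _ => permE p)) sumr_const card_prod natrM invfM mulrA.
rewrite -[LHS]mulr_natr divfK // pnatr_eq0 -lt0n; apply/card_gt0P.
by exists 1%g.
Qed.

(** Block 0 is independent of the other blocks: exchange it with a fresh copy [g], which [K] cannot
    notice in its second argument. *)
Lemma sum_res0 M n (K : {ffun T -> 'I_n} -> {ffun T * 'I_M.+1 -> 'I_n} -> R) :
  (forall g (f f' : {ffun T * 'I_M.+1 -> 'I_n}),
     (forall v, v.2 != ord0 -> f v = f' v) -> K g f = K g f') ->
  (\sum_f K (res0 f) f) * #|{ffun T -> 'I_n}|%:R = \sum_f \sum_g K g f.
Proof.
move=> Kext.
pose sw (u : {ffun T * 'I_M.+1 -> 'I_n} * {ffun T -> 'I_n}) :=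
  ([ffun v => if v.2 == ord0 then u.2 v.1 else u.1 v] : {ffun T * 'I_M.+1 -> 'I_n}, res0 u.1).
have swK : involutive sw.
  case=> f g; rewrite /sw /=; congr (_, _); apply/ffunP => v; rewrite !ffunE //=.
  by case: v => x c /=; case: eqP => [->|].
rewrite pair_bigA (reindex_inj (inv_inj swK)) /=.
rewrite [RHS](eq_bigr (fun u => K (res0 u.1) u.1)) => [|[f g] _]; last first.
  apply: Kext => -[x c] /= c0; rewrite ffunE /=.
  by rewrite (negPf c0).
rewrite -(pair_bigA _ (fun f (g : {ffun T -> 'I_n}) => K (res0 f) f)) /=.
by under [RHS]eq_bigr => f _ do rewrite sumr_const; rewrite sumrMnl mulr_natr.
Qed.

(** No labels are present yet, and the core avoids block 0, so the core map and the base map are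
    independent and uniform. *)
Lemma lifted0 M n Y m : (0 < n)%N -> @lifted R T M n Y m 0 0.
Proof.
move=> n0; set N := #|{ffun T * 'I_M.+1 -> 'I_n}|.
have cardX0 (X : finType) : (0 < #|{ffun X -> 'I_n}|)%N.
  by rewrite card_ffun card_ord expn_gt0 n0.
exists {ffun T * 'I_M.+1 -> 'I_n}, (fun=> N%:R^-1), (fun f => resS m f), (fun _ _ => set0).
split=> [_||F _].
- by rewrite invr_ge0 ler0n.
- by rewrite sumr_const -[LHS]mulr_natr mulVf // pnatr_eq0 -lt0n cardX0.
pose K g f := F g (resS m f) [ffun=> set0].
have -> : nuE Y m 0 F = \sum_w unif R w * K (res0 (vmap w)) (vmap w).
  by apply: eq_bigr => w _; congr (_ * F _ _ _).
rewrite addr0 (unif_vmap (fun f => K (res0 f) f)) -/N mulr_suml.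
rewrite [leRHS](_ : _ = \sum_f N%:R^-1 * ((\sum_g K g f) / #|{ffun T -> 'I_n}|%:R)); last first.
  by apply: eq_bigr => f _; congr (_ * (_ / _)); apply: eq_bigr => g _; congr (F _ _ _).
rewrite -mulr_suml -mulr_sumr -mulr_suml [leRHS]mulrC ler_wpM2r ?invr_ge0 ?ler0n //.
rewrite -(sum_res0 (K := K)) => [|g f f' ff]; last first.
  by congr (F _ _ _); apply/resSP => v; rewrite inE => /andP[v0 _]; apply: ff; apply: contraTneq v0 => ->.
by rewrite mulfK // pnatr_eq0 -lt0n cardX0.
Qed.

(** Climbing from [lifted0] through levels 0 to k gives a random labelling, hence a random graph,
    and some outcome is as good as the average. [M] bounds the core sizes, so it does not depend on
    [n], [Y] or [F]. *)
Theorem graph_lifting (k : nat) (d : R) : 0 < d ->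
  exists M, forall n (Y : {ffun T * 'I_M.+1 -> 'I_n} -> {set {set T * 'I_M.+1}})
    (F : {ffun T -> 'I_n} -> {set {set T}} -> R),
  (0 < n)%N -> (forall g y, 0 <= F g y <= 1) ->
  (forall (g : {ffun T -> 'I_n}) y, ~~ injectiveb g -> F g y = 0) ->
  exists G : {set {set 'I_n}}, (forall e : {set 'I_n}, e \in G -> #|e| = k) /\
    \sum_w unif R w *
      F (res0 (vmap w)) [set B : {set T} | (#|B| == k) && (emb M B \in vgraph Y w)] <=
    (\sum_g F g [set B : {set T} | (#|B| == k) && (g @: B \in G)]) / #|{ffun T -> 'I_n}|%:R + d.
Proof.
(* Each of the [k + 1] levels replaces at most 2^|T| labels at cost [d']. *)
move=> d0; pose d' := d / ((2 ^ #|T|)%:R * k.+1%:R).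
have c0 : 0 < (2 ^ #|T|)%:R * k.+1%:R :> R by rewrite mulr_gt0 ?ltr0n ?expn_gt0.
have d'0 : 0 < d' by rewrite divr_gt0.
have [M _ HM] := stable_scales_exist T d'0 k.+1 (fun i : nat => leqnn 0).
exists M => n Y F n0 F01 FI.
have [m [_ _ _ mst]] := HM M n Y (leqnn M) n0.
have lift j : (j <= k.+1)%N -> lifted Y m j ((2 ^ #|T|)%:R * d' *+ j).
  elim: j => [_|j IH jk]; first by rewrite mulr0n; apply: lifted0.
  rewrite mulrSr; apply: lifted_step => //; last exact: IH (ltnW jk).
  by move=> A Aj; apply: mst; rewrite Aj.
have [O [p [s [Lm [p0 p1 pF]]]]] := lift k.+1 (leqnn _).
have dE : (2 ^ #|T|)%:R * d' *+ k.+1 = d.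
  by rewrite -[LHS]mulr_natr mulrAC mulrC divfK // gt_eqF.
(* [set0] belongs to the label of a [k]-set exactly when the set itself is an edge. *)
pose F' (g : {ffun T -> 'I_n}) (_ : {ffun T * 'I_M.+1 -> option 'I_n})
  (l : {ffun {set T} -> {set {set T * 'I_M.+1}}}) :=
  F g [set B : {set T} | (#|B| == k) && (set0 \in l B)].
have := pF F' (conj (fun g s l => F01 g _) (fun g s l h => FI g _ h)); rewrite dE.
pose G o : {set {set 'I_n}} := [set e : {set 'I_n} | (#|e| == k) && (set0 \in Lm o e)].
pose val o := (\sum_g F g [set B : {set T} | (#|B| == k) && (g @: B \in G o)])
   / #|{ffun T -> 'I_n}|%:R.
have -> : nuE Y m k.+1 F' = \sum_w unif R w *
      F (res0 (vmap w)) [set B : {set T} | (#|B| == k) && (emb M B \in vgraph Y w)].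
  apply: eq_bigr => w _; congr (_ * F _ _); apply/setP => B; rewrite in_set [RHS]in_set ffunE /low ltnS.
  by case: eqP => //= ->; rewrite leqnn /wlab in_lab sub0set setU0.
have -> : \sum_o p o * ((\sum_g F' g (s o) (lam_at k.+1 (Lm o) g)) / #|{ffun T -> 'I_n}|%:R) =
    \sum_o p o * val o.
  apply: eq_bigr => o _; congr (_ * (_ / _)); apply: eq_bigr => g _.
  have [/injectiveP gI|gI] := boolP (injectiveb g); last by rewrite /F' !FI.
  congr (F _ _); apply/setP => B; rewrite !inE ffunE /low ltnS card_imset //.
  by case: eqP => //= ->; rewrite leqnn.
move=> h; set lhs := \sum_w _ in h *.
(* If every outcome fell short of [lhs - d], so would the average; an outcome of positive weight
   makes this strict. *)
have [/existsP[o ho]|/existsPn no] := boolP [exists o, lhs <= val o + d].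
  by exists (G o); split=> // e; rewrite inE => /andP[/eqP].
have [o0 po0] : exists o0, 0 < p o0.
  apply/existsP; apply: contraT => /existsPn pn.
  have := p1; rewrite big1 => [/eqP|o _]; first by rewrite eq_sym oner_eq0.
  by apply/eqP; rewrite eq_le p0 andbT leNgt pn.
suff : \sum_o p o * val o + d < lhs by rewrite ltNge h.
rewrite -[d]mul1r -[1]p1 -[lhs]mul1r -[1]p1 !mulr_suml -big_split /=.
rewrite (bigD1 o0) //= [ltRHS](bigD1 o0) //= ltr_leD //.
  by rewrite -mulrDr ltr_pM2l // ltNge no.
by apply: ler_sum => o _; rewrite -mulrDr ler_wpM2l // ltW // ltNge no.
Qed.

End Lifting.

(** * Random vertex maps *)

Definition pullk (k : nat) (A B : finType) (h : A -> B) (H : {set {set B}}) : {set {set A}} :=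
  [set e : {set A} | (#|e| == k) && (h @: e \in H)].

Lemma eq_pullk k (A B : finType) (h h' : A -> B) H : h =1 h' -> pullk k h H = pullk k h' H.
Proof. by move=> hh; apply/setP => e; rewrite !inE (eq_imset _ hh). Qed.

Lemma pullk_comp k (A B C : finType) (g : A -> B) (f : B -> C) (H : {set {set C}}) :
  injective g -> pullk k g (pullk k f H) = pullk k (f \o g) H.
Proof.
by move=> gI; apply/setP => e; rewrite !inE card_imset // -imset_comp andbA andbb.
Qed.

Section Averages.
Variable R : realFieldType.

Definition mean (X : finType) (K : X -> R) : R := (\sum_x K x) / #|X|%:R.

Lemma mean_bound (X : finType) (K : X -> R) (B : R) :
  (0 < #|X|)%N -> (forall x, 0 <= K x <= B) -> 0 <= mean K <= B.
Proof.
move=> X0 KB; have X0' : 0 < #|X|%:R :> R by rewrite ltr0n.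
rewrite /mean divr_ge0 ?ler0n //=; last first.
  by apply: sumr_ge0 => x _; case/andP: (KB x).
rewrite ler_pdivrMr // mulr_natr -sumr_const; apply: ler_sum => x _.
by case/andP: (KB x).
Qed.

Lemma sum_perm_eq n (K : {perm 'I_n} -> R) v : \sum_s K (v * s)%g = \sum_s K s.
Proof. by rewrite [RHS](reindex_inj (mulgI v)). Qed.

Lemma perm_onto (A B : finType) (w h : A -> B) : injective w -> injective h ->
  exists v : {perm B}, forall x, v (w x) = h x.
Proof.
move=> wI hI; pose g y := odflt y (omap h [pick x | w x == y]).
have gw x : g (w x) = h x.
  rewrite /g; case: pickP => [x' /eqP /wI -> //|/(_ x)]; by rewrite eqxx.
have gI : {in w @: [set: A] &, injective g}.
  by move=> _ _ /imsetP[x _ ->] /imsetP[y _ ->]; rewrite !gw => /hI ->.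
have [v vE] := perm_extend gI.
by exists v => x; rewrite vE ?gw // imset_f.
Qed.

Section InjectiveSamples.
Variables (J : finType) (n : nat) (w : J -> 'I_n) (K : {ffun J -> 'I_n} -> R) (B : R).
Hypotheses (w_inj : injective w) (n_gt0 : (0 < n)%N) (KB : forall h, 0 <= K h <= B).

(** A random permutation restricted to a fixed injective tuple is a uniform injection: the values of
    [K] at [s] after [h] are summed over all pairs in two ways. *)
Lemma sum_inj_perm :
  (\sum_(h : {ffun J -> 'I_n} | injectiveb h) K h) * #|{: {perm 'I_n}}|%:R =
  (\sum_(s : {perm 'I_n}) K [ffun i => s (w i)]) *
    #|[set h : {ffun J -> 'I_n} | injectiveb h]|%:R.
Proof.
have compE (h : {ffun J -> 'I_n}) : injectiveb h ->
    \sum_(s : {perm 'I_n}) K [ffun i => s (h i)] =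
    \sum_(s : {perm 'I_n}) K [ffun i => s (w i)].
  move/injectiveP => hI; have [v vE] := perm_onto w_inj hI.
  rewrite -[RHS](sum_perm_eq _ v); apply: eq_bigr => s _; congr K.
  by apply/ffunP => i; rewrite !ffunE permM vE.
transitivity (\sum_(h : {ffun J -> 'I_n} | injectiveb h)
    \sum_(s : {perm 'I_n}) K [ffun i => s (h i)]); last first.
  rewrite (eq_bigr _ compE) mulr_natr -sumr_const.
  by apply: eq_bigl => h; rewrite inE.
rewrite exchange_big /= mulr_natr -sumr_const; apply: eq_big => // s _.
pose a (h : {ffun J -> 'I_n}) := [ffun i => s (h i)].
have aI : injective a.
  move=> h h' /ffunP E; apply/ffunP => i; have := E i; rewrite !ffunE; exact: perm_inj.
rewrite (reindex_inj aI); apply: eq_bigl => h.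
apply/injectiveP/injectiveP => [aE x y hxy|hI x y]; first by apply: aE; rewrite !ffunE hxy.
by rewrite !ffunE => /perm_inj /hI.
Qed.

End InjectiveSamples.

Lemma ffact_le_exp n r : (n ^_ r <= n ^ r)%N.
Proof.
by elim: r => // r IH; rewrite ffactnSr expnSr leq_mul ?leq_subr.
Qed.

(** Division-free birthday bound: a random map from [r] points to [n] points is non-injective with
    probability at most r^2 / n. *)
Lemma ffact_lower n r : (r <= n)%N -> (n ^ r * n <= n ^_ r * n + r ^ 2 * n ^ r)%N.
Proof.
elim: r => [|r IH] rn; first by rewrite expn0 ffactn0 leq_addr.
have := IH (ltnW rn); have := ffact_le_exp n r; rewrite ffactnSr (expnSr n).
move: (n ^_ r)%N (n ^ r)%N => a N; have [t nE] : exists t, n = (r + t.+1)%N.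
  by exists (n - r.+1)%N; rewrite addnS -addSn subnKC.
rewrite {}nE addKn -!mulnn => h1 h2.
have := leq_mul h1 (leqnn (r * (r + t.+1))); have := leq_mul h2 (leqnn (r + t.+1)).
by move: t.+1 => u; nia.
Qed.

Lemma noninj_mean (J : finType) n : (#|J| <= n)%N -> (0 < n)%N ->
  mean (fun h : {ffun J -> 'I_n} => (~~ injectiveb h)%:R) <= (#|J| ^ 2)%:R / n%:R.
Proof.
move=> Jn n0; have N0 : 0 < (n ^ #|J|)%:R :> R by rewrite ltr0n expn_gt0 n0.
have n0' : 0 < n%:R :> R by rewrite ltr0n.
rewrite /mean -natr_sum card_ffun card_ord ler_pdivrMr // mulrAC ler_pdivlMr //.
have := ffact_lower Jn; rewrite -[X in (X ^_ _)%N]card_ord -card_inj_ffuns -!natrM ler_nat.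
have := cardsC [set h : {ffun J -> 'I_n} | injectiveb h].
rewrite card_ffun card_ord => <-.
have -> : (\sum_(h : {ffun J -> 'I_n}) ~~ injectiveb h =
    #|~: [set h : {ffun J -> 'I_n} | injectiveb h]|)%N.
  rewrite -sum1_card [RHS]big_mkcond; apply: eq_bigr => h _; rewrite !inE.
  by case: injectiveb.
move: #|~: _| #|finset _| (#|J| ^ 2)%N => x y z; nia.
Qed.

(** Sampling with and without replacement agree on injective maps; the non-injective ones have
    weight at most |J|^2 / n, and [K] is at most [B] there. *)
Lemma mean_perm_close (J : finType) (n : nat) (w : J -> 'I_n)
    (K : {ffun J -> 'I_n} -> R) (B : R) :
  injective w -> (0 < n)%N -> (forall h, 0 <= K h <= B) ->
  mean (fun s : {perm 'I_n} => K [ffun i => s (w i)]) - B * ((#|J| ^ 2)%:R / n%:R)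
  <= mean K <=
  mean (fun s : {perm 'I_n} => K [ffun i => s (w i)]) + B * ((#|J| ^ 2)%:R / n%:R).
Proof.
move=> wI n0 KB; set D := B * _; set a := mean (fun s : {perm _} => _).
have Jn : (#|J| <= n)%N by rewrite -[n]card_ord; apply: leq_card wI.
have N0 : 0 < #|{ffun J -> 'I_n}|%:R :> R by rewrite card_ffun card_ord ltr0n expn_gt0 n0.
have P0 : 0 < #|{: {perm 'I_n}}|%:R :> R by rewrite ltr0n; apply/card_gt0P; exists 1%g.
have B0 : 0 <= B.
  have [k0 kB] := andP (KB [ffun i => w i]); exact: le_trans k0 kB.
have aB : 0 <= a <= B by apply: mean_bound => //; rewrite -(ltr0n R).
pose bad := mean (fun h : {ffun J -> 'I_n} => (~~ injectiveb h)%:R).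
have badD : B * bad <= D by rewrite ler_wpM2l // noninj_mean.
have bad0 : 0 <= bad.
  by rewrite /bad /mean divr_ge0 ?ler0n // sumr_ge0 // => h _; apply: ler0n.
have goodE : #|[set h : {ffun J -> 'I_n} | injectiveb h]|%:R =
    #|{ffun J -> 'I_n}|%:R * (1 - bad).
  rewrite mulrBr mulr1 /bad /mean mulrC divfK ?gt_eqF //.
  apply/eqP; rewrite eq_sym subr_eq -natr_sum -natrD; apply/eqP; congr _%:R.
  rewrite -sum1_card [X in (_ = X + _)%N]big_mkcond -big_split /= -sum1_card.
  by apply: eq_bigr => h _; rewrite inE; case: injectiveb.
have injE : \sum_(h : {ffun J -> 'I_n} | injectiveb h) K h =
    #|{ffun J -> 'I_n}|%:R * ((1 - bad) * a).
  apply: (mulIf (lt0r_neq0 P0)); rewrite (sum_inj_perm K wI) goodE /a /mean.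
  by field; rewrite gt_eqF.
have meanE : mean K = (1 - bad) * a +
    (\sum_(h : {ffun J -> 'I_n} | ~~ injectiveb h) K h) / #|{ffun J -> 'I_n}|%:R.
  rewrite /mean (bigID (fun h : {ffun J -> 'I_n} => injectiveb h)) /= injE.
  by field; rewrite gt_eqF.
have rest : 0 <= (\sum_(h : {ffun J -> 'I_n} | ~~ injectiveb h) K h)
    / #|{ffun J -> 'I_n}|%:R <= B * bad.
  rewrite divr_ge0 ?ler0n //=; last by apply: sumr_ge0 => h _; case/andP: (KB h).
  rewrite /bad /mean mulrA ler_pM2r ?invr_gt0 // mulr_sumr big_mkcond.
  apply: ler_sum => h _; case: ifP => _; rewrite ?mulr1 ?mulr0 //.
  by case/andP: (KB h).
rewrite meanE; case/andP: aB => a0 aB; case/andP: rest => r0 rB.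
have := ler_wpM2r bad0 aB; set ab := a * bad => abB.
have ab0 : 0 <= ab by rewrite mulr_ge0.
have -> : (1 - bad) * a = a - ab by rewrite /ab; ring.
by apply/andP; split; lra.
Qed.

(** A random permutation carries a fixed [k]-set to a uniform [k]-set, so one probe of [D] has mean
    its density. *)
Lemma edge_perm_mean k n (D : {set {set 'I_n}}) (A : {set 'I_n}) :
  (forall e, e \in D -> #|e| = k) -> #|A| = k ->
  mean (fun s : {perm 'I_n} => (s @: A \in D)%:R) = #|D|%:R / 'C(n, k)%:R.
Proof.
move=> Dk Ak; have kn : (k <= n)%N by rewrite -Ak -[n in leqRHS]card_ord max_card.
have C0 : 'C(n, k)%:R != 0 :> R by rewrite pnatr_eq0 -lt0n bin_gt0.
have P0 : #|{: {perm 'I_n}}|%:R != 0 :> R.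
  by rewrite pnatr_eq0 -lt0n; apply/card_gt0P; exists 1%g.
have transA (A' : {set 'I_n}) : #|A'| = k -> exists v : {perm 'I_n}, v @: A = A'.
  move=> A'k; pose h x := nth x (enum A') (index x (enum A)).
  have idx x : x \in A -> (index x (enum A) < size (enum A'))%N.
    by move=> xA; rewrite -cardE A'k -Ak cardE index_mem mem_enum.
  have hI : {in A &, injective h}.
    move=> x y xA yA; rewrite /h (set_nth_default y) ?idx // => /eqP.
    rewrite nth_uniq ?idx ?enum_uniq // => /eqP E.
    have xe : x \in enum A by rewrite mem_enum.
    have ye : y \in enum A by rewrite mem_enum.
    by rewrite -(nth_index x xe) E nth_index.
  have [v vE] := perm_extend hI; exists v; apply/eqP.
  rewrite eqEcard card_imset ?A'k ?Ak ?leqnn ?andbT; last exact: perm_inj.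
  apply/subsetP => _ /imsetP[x xA ->]; rewrite vE // /h -mem_enum mem_nth // idx //.
rewrite /mean; apply: (mulIf P0); rewrite divfK //; apply: (mulIf C0).
rewrite mulrAC divfK //.
transitivity (\sum_(A' : {set 'I_n} | #|A'| == k)
    \sum_(s : {perm 'I_n}) (s @: A' \in D)%:R : R).
  have -> : 'C(n, k) = #|[set A' : {set 'I_n} | #|A'| == k]| by rewrite card_draws card_ord.
  rewrite mulr_natr -sumr_const.
  apply: eq_big => [A'|A']; first by rewrite inE.
  rewrite inE => /eqP /transA[v <-]; rewrite -[LHS](sum_perm_eq _ v).
  apply: eq_bigr => s _; suff -> : (v * s)%g @: A = s @: (v @: A) by [].
  by rewrite -imset_comp; apply: eq_in_imset => x _; rewrite /= permM.
rewrite exchange_big mulr_natr -sumr_const; apply: eq_big => // s _.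
rewrite -natr_sum; congr (_%:R); rewrite -sum1_card.
rewrite (reindex_inj (imset_inj (@perm_inj _ s^-1))) big_mkcond [RHS]big_mkcond.
apply: eq_bigr => e _; rewrite card_imset; last exact: perm_inj.
rewrite -imset_comp (_ : _ @: e = e); last first.
  by rewrite -[RHS]imset_id; apply: eq_in_imset => x _; rewrite /= permKV.
have [eD|//] := boolP (e \in D); last by case: ifP.
by rewrite (Dk _ eD) eqxx.
Qed.

End Averages.

(** * Second moment bound for independent blocks *)

Section Concentration.
Variables (R : realFieldType) (I J : finType) (n : nat).

Definition block (g : {ffun I * J -> 'I_n}) (b : I) : {ffun J -> 'I_n} := [ffun i => g (b, i)].

Definition block_mean (K : {ffun J -> 'I_n} -> R) (g : {ffun I * J -> 'I_n}) : R :=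
  mean (fun b => K (block g b)).

Lemma sum_blocks (Q : {ffun I -> {ffun J -> 'I_n}} -> R) :
  \sum_(g : {ffun I * J -> 'I_n}) Q [ffun b => block g b] =
  \sum_(G : {ffun I -> {ffun J -> 'I_n}}) Q G.
Proof.
pose u (G : {ffun I -> {ffun J -> 'I_n}}) : {ffun I * J -> 'I_n} := [ffun p => G p.1 p.2].
rewrite (reindex u) /=.
  apply: eq_bigr => G _; congr Q; apply/ffunP => b; apply/ffunP => i; by rewrite !ffunE.
exists (fun g : {ffun I * J -> 'I_n} => [ffun b => block g b]) => [G _|g _].
  by apply/ffunP => b; apply/ffunP => i; rewrite !ffunE.
by apply/ffunP => -[b i]; rewrite !ffunE.
Qed.

Lemma sum_indep (L : finType) (z : L -> R) (b b' : I) : b != b' -> \sum_l z l = 0 ->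
  \sum_(G : {ffun I -> L}) z (G b) * z (G b') = 0.
Proof.
move=> bb z0; pose F i l := if i == b then z l else if i == b' then z l else 1.
transitivity (\sum_(G : {ffun I -> L}) \prod_i F i (G i)).
  apply: eq_bigr => G _; rewrite (bigD1 b) //= (bigD1 b') 1?eq_sym //= /F !eqxx.
  rewrite eq_sym (negPf bb) big1 ?mulr1 // => i /andP[/negPf -> /negPf ->] //.
rewrite -bigA_distr_bigA (bigD1 b) //= [X in X * _](_ : _ = 0) ?mul0r //.
by rewrite -[RHS]z0; apply: eq_bigr => l _; rewrite /F eqxx.
Qed.

(** Chebyshev in counting form: distinct blocks are independent, so only the diagonal terms of the
    squared centred sum survive. *)
Lemma block_mean_deviation (K : {ffun J -> 'I_n} -> R) (B c : R) :
  (0 < #|I|)%N -> (0 < n)%N -> 0 < c -> (forall h, 0 <= K h <= B) ->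
  #|[set g | c <= `|block_mean K g - mean K|]|%:R * (#|I|%:R * c ^+ 2) <=
  B ^+ 2 * #|{ffun I * J -> 'I_n}|%:R.
Proof.
move=> I0 n0 c0 KB.
have N0 : (0 < #|{ffun J -> 'I_n}|)%N by rewrite card_ffun card_ord expn_gt0 n0.
have I0' : 0 < #|I|%:R :> R by rewrite ltr0n.
pose z h := K h - mean K.
have zB h : z h ^+ 2 <= B ^+ 2.
  have /andP[m0 mB] := mean_bound N0 KB; have /andP[k0 kB] := KB h.
  rewrite -real_normK ?num_real // ler_sqr ?nnegrE ?normr_ge0 ?(le_trans k0 kB) //.
  by rewrite ler_norml /z; apply/andP; split; lra.
have z0 : \sum_h z h = 0.
  rewrite sumrB sumr_const -[X in _ - X]mulr_natr /mean divfK ?subrr //.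
  by rewrite pnatr_eq0 -lt0n.
have var : \sum_(g : {ffun I * J -> 'I_n}) (\sum_b z (block g b)) ^+ 2 <=
    #|I|%:R * (B ^+ 2 * #|{ffun I * J -> 'I_n}|%:R).
  have sqE g : (\sum_b z (block g b)) ^+ 2 =
      \sum_b \sum_b' z (block g b) * z (block g b').
    rewrite expr2 mulr_suml; apply: eq_bigr => b _; exact: mulr_sumr.
  under eq_bigr => g _ do rewrite sqE.
  rewrite exchange_big mulr_natl -sumr_const; apply: ler_sum => b _.
  rewrite exchange_big (bigD1 b) //= [X in _ + X]big1 ?addr0 => [|b' bb']; last first.
    rewrite -[RHS](@sum_indep _ z b b' _ z0) 1?eq_sym //.
    rewrite -(sum_blocks (fun G => z (G b) * z (G b'))).
    by apply: eq_bigr => g _; rewrite !ffunE.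
  rewrite mulr_natr -sumr_const; apply: ler_sum => g _.
  by rewrite -expr2 zB.
have devE g : #|I|%:R * (block_mean K g - mean K) = \sum_b z (block g b).
  rewrite /block_mean {1}/mean mulrBr mulrC divfK ?gt_eqF // sumrB sumr_const.
  by rewrite mulr_natl.
rewrite -(ler_pM2l I0'); apply: le_trans var.
rewrite -sum1_card natr_sum mulr_suml mulr_sumr big_mkcond.
apply: ler_sum => g _; rewrite inE -devE; case: ifP => [h|_]; last exact: sqr_ge0.
rewrite exprMn mul1r mulrA -expr2 ler_pM2l ?exprn_gt0 //.
by rewrite -[leRHS]real_normK ?num_real // ler_sqr ?nnegrE ?normr_ge0 ?(ltW c0) //.
Qed.

End Concentration.

(** * Samples of samples *)

Section SampleTest.
Variables (R : archiRealFieldType) (k r s : nat).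
Local Notation T := ('I_s * 'I_r)%type.

Definition first_ords : {set 'I_r} := [set i : 'I_r | (i < k)%N].

Lemma card_first_ords : (k <= r)%N -> #|first_ords| = k.
Proof.
move=> kr; have wI : injective (widen_ord kr) by move=> i j [] E; apply: val_inj.
rewrite -[RHS](card_ord k) -(card_imset _ wI).
apply: eq_card => i; rewrite inE; apply/idP/imsetP => [ik|[j _ ->]]; last by rewrite /= ltn_ord.
by exists (Ordinal ik) => //; apply: val_inj.
Qed.

Definition gdiff (A : finType) (x y : {set {set A}}) : {set {set A}} := (x :\: y) :|: (y :\: x).

(** [T] consists of [s] blocks of [r] vertices. The threshold 1/2 lies between the 2/3 and 1/3 of
    the tester; the set [first_ords] in each block probes the edit density. *)
Definition sample_good (phi : {set {set 'I_r}} -> R) (th : R) (x y : {set {set T}}) : bool :=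
  (1 / 2 <= mean (fun b : 'I_s => phi (pullk k (pair b) y))) &&
  (mean (fun b : 'I_s => (pair b @: first_ords \in gdiff x y)%:R) <= th).

Definition acceptK n (phi : {set {set 'I_r}} -> R) (G : {set {set 'I_n}})
  (h : {ffun 'I_r -> 'I_n}) : R := phi (pullk k h G).
Definition editK n (D : {set {set 'I_n}}) (h : {ffun 'I_r -> 'I_n}) : R :=
  (h @: first_ords \in D)%:R.

Lemma sample_good_pull n phi th (g : {ffun T -> 'I_n}) (H G : {set {set 'I_n}}) :
  (k <= r)%N ->
  sample_good phi th (pullk k g H) (pullk k g G) =
  (1 / 2 <= block_mean (acceptK phi G) g) && (block_mean (editK (gdiff H G)) g <= th).
Proof.
move=> kr; have pI (b : 'I_s) : injective (pair b : 'I_r -> T) by move=> x y [].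
have gE b : block g b =1 g \o pair b by move=> i; rewrite ffunE.
congr (_ && _).
  congr (_ <= _); congr (_ / _); apply: eq_bigr => b _; rewrite /acceptK; congr phi.
  by rewrite pullk_comp // (eq_pullk _ _ (gE b)).
congr (_ <= _); congr (_ / _); apply: eq_bigr => b _.
have imE : block g b @: first_ords = g @: (pair b @: first_ords).
  by rewrite -imset_comp; apply: eq_imset.
have cE : #|pair b @: first_ords| = k by rewrite card_imset // card_first_ords.
by rewrite /editK imE /gdiff !in_setU !in_setD ![_ \in pullk _ _ _]in_set cE eqxx.
Qed.

Section Blocks.
Variable M : nat.
Local Notation V := (T * 'I_M.+1)%type.

Definition base (p : {perm V}) (x : T) : V := p (x, ord0).

Lemma base_inj p : injective (base p).
Proof. by move=> x y /perm_inj []. Qed.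

(** [y] is a candidate for the trace on [V] of a nearby graph that the tester accepts; it must pass
    on at least 9/10 of the placements of [T] in [V]. *)
Definition host_cond (phi : {set {set 'I_r}} -> R) (th : R) (x y : {set {set V}}) : bool :=
  (9 * #|{: {perm V}}| <=
   10 * #|[set p | sample_good phi th (pullk k (base p) x) (pullk k (base p) y)]|)%N.

Definition host_good phi th (x : {set {set V}}) : bool := [exists y, host_cond phi th x y].

Lemma pull_base n (f : {ffun V -> 'I_n}) p (H : {set {set 'I_n}}) :
  pullk k (base p) (pullk k f H) = pullk k (res0 (vmap (f, p))) H.
Proof.
rewrite pullk_comp; last exact: base_inj.
by apply: eq_pullk => x; rewrite !ffunE.
Qed.

Lemma mean_vmap n (K : {ffun T -> 'I_n} -> R) : (0 < n)%N ->
  mean (fun w : {ffun V -> 'I_n} * {perm V} => K (res0 (vmap w))) = mean K.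
Proof.
move=> n0; rewrite /mean mulr_suml.
rewrite (eq_bigr (fun w => unif R w * K (res0 (vmap w)))) => [|w _]; last by rewrite mulrC.
rewrite (unif_vmap (fun f => K (res0 f))).
have X0 (X : finType) : #|{ffun X -> 'I_n}|%:R != 0 :> R.
  by rewrite pnatr_eq0 -lt0n card_ffun card_ord expn_gt0 n0.
apply: (mulIf (X0 T)); rewrite mulrAC (sum_res0 (K := fun g _ => K g)) //.
by rewrite sumr_const -[X in X / _ = _]mulr_natr mulfK // divfK.
Qed.

Lemma sum_pairs n (K : {ffun V -> 'I_n} * {perm V} -> R) :
  mean K = mean (fun f => mean (fun p => K (f, p))).
Proof.
rewrite /mean -mulr_suml -mulrA -invfM -natrM mulnC -card_prod pair_bigA.
by congr (_ / _); apply: eq_bigr => -[].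
Qed.

Lemma mean_le (X : finType) (K K' : X -> R) : (forall x, K x <= K' x) -> mean K <= mean K'.
Proof.
by move=> KK; rewrite ler_wpM2r ?invr_ge0 ?ler0n // ler_sum.
Qed.

Lemma meanZ (X : finType) (c : R) (K : X -> R) : mean (fun x => c * K x) = c * mean K.
Proof. by rewrite /mean -mulr_sumr mulrA. Qed.

Lemma meanB (X : finType) (K K' : X -> R) : mean (fun x => K x - K' x) = mean K - mean K'.
Proof. by rewrite /mean sumrB mulrBl. Qed.

Lemma mean_const (X : finType) (c : R) : (0 < #|X|)%N -> mean (fun _ : X => c) = c.
Proof.
by move=> X0; rewrite /mean sumr_const -[X in X / _]mulr_natr mulfK // pnatr_eq0 -lt0n.
Qed.

Lemma mean_pred (X : finType) (P : pred X) : mean (fun x => (P x)%:R : R) = #|[set x | P x]|%:R / #|X|%:R.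
Proof.
rewrite /mean -natr_sum -[in RHS]sum1_card [in RHS]big_mkcond; congr (_%:R / _).
by apply: eq_bigr => x _; rewrite inE; case: (P x).
Qed.

(** Markov with [y] the pullback of [G]: rejection needs more than 1/10 bad placements, while their
    average is at most 1/50. *)
Lemma host_complete n phi th (H G : {set {set 'I_n}}) : (0 < n)%N ->
  mean (fun g : {ffun T -> 'I_n} =>
    (~~ sample_good phi th (pullk k g H) (pullk k g G))%:R : R) <= 1 / 50 ->
  4 / 5 <= mean (fun f : {ffun V -> 'I_n} => (host_good phi th (pullk k f H))%:R : R).
Proof.
move=> n0 bad.
have P0 : 0 < #|{: {perm V}}|%:R :> R by rewrite ltr0n; apply/card_gt0P; exists 1%g.
have F0 : 0 < #|{ffun V -> 'I_n}|%:R :> R by rewrite ltr0n card_ffun card_ord expn_gt0 n0.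
rewrite -(mean_vmap _ n0) sum_pairs in bad.
have le_f (f : {ffun V -> 'I_n}) : 1 - (host_good phi th (pullk k f H))%:R <=
    10 * mean (fun p => (~~ sample_good phi th (pullk k (res0 (vmap (f, p))) H)
                           (pullk k (res0 (vmap (f, p))) G))%:R : R).
  rewrite mean_pred; have [_|ngood] := boolP (host_good _ _ _).
    by rewrite subrr mulr_ge0 ?divr_ge0 ?ler0n.
  rewrite subr0 mulrA ler_pdivlMr // mul1r -natrM ler_nat.
  move/existsPn: ngood => /(_ (pullk k f G)); rewrite /host_cond.
  set S := [set p | _]; set S' := [set p | _].
  have -> : S' = ~: S by apply/setP => p; rewrite !inE !pull_base.
  by rewrite -(cardsC S); move: #|S| #|~: S| => a b; lia.
have := mean_le le_f; rewrite meanB meanZ mean_const -?(ltr0n R) // => h.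
by move: bad h; set a := mean _; set b := mean _; lra.
Qed.

End Blocks.

(** [graph_lifting] applied to the witnesses [y]: of 1/3 times 9/10 = 3/10, non-injective samples
    cost 1/10 and the lifting costs 1/10. *)
Lemma host_sound : exists M, forall n (phi : {set {set 'I_r}} -> R) (th : R) (H : {set {set 'I_n}}),
  (k <= r)%N -> (0 < n)%N -> (10 * (s * r) ^ 2 <= n)%N -> (s * r <= n)%N ->
  1 / 3 <= mean (fun f : {ffun T * 'I_M.+1 -> 'I_n} => (host_good phi th (pullk k f H))%:R : R) ->
  exists G : {set {set 'I_n}}, (forall e : {set 'I_n}, e \in G -> #|e| = k) /\
    1 / 10 <= mean (fun g : {ffun T -> 'I_n} =>
      (sample_good phi th (pullk k g H) (pullk k g G))%:R : R).
Proof.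
have d0 : 0 < 1 / 10 :> R by lra.
have [M HM] := graph_lifting (T : finType) k d0; exists M => n phi th H kr n0 nbig nT hgood.
(* An arbitrary witness is chosen for each [f] separately, with no consistency between samples;
   [set0] stands in when there is none. *)
pose Y (f : {ffun T * 'I_M.+1 -> 'I_n}) : {set {set T * 'I_M.+1}} :=
  odflt set0 [pick y | host_cond phi th (pullk k f H) y].
pose F (g : {ffun T -> 'I_n}) y : R := (injectiveb g && sample_good phi th (pullk k g H) y)%:R.
have F01 g y : 0 <= F g y <= 1 by rewrite ler0n lern1 leq_b1.
have FI (g : {ffun T -> 'I_n}) y : ~~ injectiveb g -> F g y = 0 by rewrite /F => /negPf ->.
have [G [Gk]] := HM n Y F n0 F01 FI; rewrite -/(mean _) => FG.
exists G; split=> //; move: FG.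
have F_le (g : {ffun T -> 'I_n}) y : F g y <= (sample_good phi th (pullk k g H) y)%:R.
  by rewrite /F; case: injectiveb; rewrite //= ler0n.
have := mean_le (fun g => F_le g (pullk k g G)).
pose S w : R := (sample_good phi th (pullk k (res0 (vmap w)) H)
   (pullk k (base w.2) (Y w.1)))%:R.
pose N (g : {ffun T -> 'I_n}) : R := (~~ injectiveb g)%:R.
have FS (w : {ffun T * 'I_M.+1 -> 'I_n} * {perm (T * 'I_M.+1)}) : S w - N (res0 (vmap w)) <=
   F (res0 (vmap w)) [set B : {set T} | (#|B| == k) && (emb M B \in vgraph Y w)].
  rewrite (_ : [set B : {set T} | _] = pullk k (base w.2) (Y w.1)); last first.
    apply/setP => B; rewrite !in_set.
    by suff -> : base w.2 @: B = w.2 @: emb M B by []; rewrite -imset_comp; apply: eq_imset.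
  rewrite /S /N /F; case: injectiveb => /=; first by rewrite subr0.
  by rewrite subr_le0 lern1 leq_b1.
have := mean_le FS; rewrite meanB (mean_vmap M N n0).
have Nsmall : mean N <= 1 / 10.
  have := @noninj_mean R (T : finType) n; rewrite card_prod !card_ord => /(_ nT n0) h.
  apply: le_trans h _; rewrite ler_pdivrMr ?ltr0n // mul1r mulrC ler_pdivlMr ?ltr0n //.
  by rewrite -natrM ler_nat mulnC.
have Sbig : 3 / 10 <= mean S.
  rewrite sum_pairs.
  have P0 : 0 < #|{: {perm (T * 'I_M.+1)}}|%:R :> R.
    by rewrite ltr0n; apply/card_gt0P; exists 1%g.
  have : mean (fun f : {ffun T * 'I_M.+1 -> 'I_n} =>
        9 / 10 * (host_good phi th (pullk k f H))%:R) <=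
      mean (fun f => mean (fun p => S (f, p))).
    apply: mean_le => f; rewrite /S mean_pred.
    have [/existsP[y hy]|_] := boolP (host_good _ _ _); last first.
      by rewrite mulr0 divr_ge0 ?ler0n.
    have : host_cond phi th (pullk k f H) (Y f).
      by rewrite /Y; case: pickP => //= /(_ y); rewrite hy.
    rewrite /host_cond mulr1 ler_pdivlMr // mulrAC ler_pdivrMr // -!natrM ler_nat.
    move=> hc; rewrite [X in (_ <= X)%N]mulnC; apply: leq_trans hc _; rewrite leq_mul2l /=.
    by apply: subset_leq_card; apply/subsetP => p; rewrite !in_set pull_base.
  by rewrite meanZ; apply: le_trans; lra.
pose SF := mean (fun w : {ffun T * 'I_M.+1 -> 'I_n} * {perm (T * 'I_M.+1)} =>
  F (res0 (vmap w)) [set B : {set T} | (#|B| == k) && (emb M B \in vgraph Y w)]).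
move=> h1 h2 h3.
have {}h3 : SF <= mean (fun g => F g (pullk k g G)) + 1 / 10.
  by rewrite /SF {1}/mean mulrC mulr_sumr; exact: h3.
move: h1 h2 h3 Sbig Nsmall; rewrite -/SF; set a := mean S; set b := mean N.
by set e := mean _; set g := mean _; lra.
Qed.

End SampleTest.

(** * Query trees *)

Section Tester.
Variables (k n r : nat) (rn : (r <= n)%N).
Local Notation path_t := (seq ({set 'I_n} * bool)).
Local Notation widen := (@widen_ord r n rn).

Fixpoint accepting_paths (t : qtree n) : seq path_t :=
  match t with
  | Leaf b => if b then [:: [::]] else [::]
  | Query e t0 t1 => [seq (e, false) :: p | p <- accepting_paths t0] ++
                     [seq (e, true) :: p | p <- accepting_paths t1]
  end.

Definition agree (A : finType) (p : seq ({set A} * bool)) (H : {set {set A}}) : bool :=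
  all (fun x => (x.1 \in H) == x.2) p.

(** A graph follows exactly one path from the root to a leaf, so the sum has at most one nonzero
    term. *)
Lemma run_paths t H : nat_of_bool (run t H) = (\sum_(p <- accepting_paths t) agree p H)%N.
Proof.
elim: t => [[]|e t0 IH0 t1 IH1] /=; rewrite ?big_nil ?big_seq1 //.
rewrite big_cat !big_map /=; case: (e \in H).
  by rewrite [X in (X + _)%N]big1_eq IH1 add0n.
by rewrite [X in (_ + X)%N]big1_eq IH0 addn0.
Qed.

Lemma accepting_paths_size t : (size (accepting_paths t) <= 2 ^ qdepth t)%N.
Proof.
elim: t => [[]|e t0 IH0 t1 IH1] //=; rewrite size_cat !size_map expnS mul2n -addnn.
by apply: leq_add; [apply: leq_trans IH0 _|apply: leq_trans IH1 _];
   rewrite leq_exp2l // ?leq_maxl ?leq_maxr.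
Qed.

Lemma accepting_paths_short t q p : (qdepth t <= q)%N -> queries_ksets k t ->
  p \in accepting_paths t -> (size p <= q)%N /\ all (fun x : {set 'I_n} * bool => #|x.1| == k) p.
Proof.
elim: t q p => [[]|e t0 IH0 t1 IH1] [|q] p //=; rewrite ?inE; try by move=> _ _ /eqP ->.
rewrite ltnS geq_max => /andP[q0 q1] /andP[/andP[ek k0] k1].
by rewrite mem_cat => /orP[] /mapP[p' p'P ->] /=; rewrite ek;
  [case: (IH0 q p') | case: (IH1 q p')].
Qed.

Lemma in_relabel (s : {perm 'I_n}) (H : hgraph n) (e : {set 'I_n}) :
  (e \in relabel s H) = (s^-1%g @: e \in H).
Proof.
have sK : cancel (fun e : {set 'I_n} => s @: e) (fun e => s^-1%g @: e).
  move=> x; rewrite -imset_comp -[RHS]imset_id; apply: eq_in_imset => i _ /=.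
  exact: permK.
have sK' : cancel (fun e : {set 'I_n} => s^-1%g @: e) (fun e => s @: e).
  move=> x; rewrite -imset_comp -[RHS]imset_id; apply: eq_in_imset => i _ /=.
  exact: permKV.
apply/imsetP/idP => [[e0 e0H ->]|eH]; first by rewrite sK.
by exists (s^-1%g @: e); rewrite ?sK'.
Qed.

(* Each accepting path is moved into the first [r] vertices by a permutation of its
   own, so the resulting pattern function is bounded by the number of paths, not
   by 1. *)
Lemma path_pattern q (p : path_t) : (k * q <= r)%N -> (size p <= q)%N ->
  all (fun x : {set 'I_n} * bool => #|x.1| == k) p ->
  exists p' : seq ({set 'I_r} * bool), forall H : hgraph n,
    (\sum_(s : {perm 'I_n}) agree p (relabel s H) =
     \sum_(s : {perm 'I_n}) agree p' (pullk k (fun i => s (widen i)) H))%N.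
Proof.
move=> kq pq pk; pose U := \bigcup_(x <- p) x.1.
have Ur : (#|U| <= r)%N.
  apply: leq_trans kq; apply: leq_trans (leq_mul (leqnn k) pq).
  rewrite /U; elim: p pk {pq U} => [|x p IH] /=; first by rewrite big_nil cards0.
  case/andP=> /eqP xk /IH {}IH; rewrite big_cons mulnS -xk.
  by apply: leq_trans (leq_card_setU _ _) _; rewrite leq_add2l xk.
have pU x : x \in p -> x.1 \subset U.
  by move=> xp; rewrite /U (big_rem x) //= subsetUl.
(* The at most [k * q] vertices met by the path are packed into the first [r]; the default [x] is
   only used outside [U]. *)
pose h (x : 'I_n) : 'I_n := insubd x (index x (enum U)).
have hlt x : x \in U -> (index x (enum U) < r)%N.
  by move=> xU; apply: leq_trans Ur; rewrite cardE index_mem mem_enum.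
have hE x : x \in U -> h x = index x (enum U) :> nat.
  by move=> xU; rewrite /h val_insubd (leq_trans (hlt x xU) rn).
have hI : {in U &, injective h}.
  move=> x y xU yU hxy; have : index x (enum U) = index y (enum U) by rewrite -!hE ?hxy.
  by move=> E; rewrite -(@nth_index _ x x (enum U)) ?mem_enum // E nth_index ?mem_enum.
have [v vE] := perm_extend hI.
have vr x : x \in p -> widen @: (widen @^-1: (v @: x.1)) = v @: x.1.
  move=> xp; apply/setP => i; apply/imsetP/idP => [[j]|].
    by rewrite inE => jv ->.
  case/imsetP => y yx ->; have yU : y \in U by apply: (subsetP (pU x xp)).
  have vlt : (v y < r)%N by rewrite vE // hE // hlt.
  have wE : widen (Ordinal vlt) = v y by apply: val_inj.
  by exists (Ordinal vlt) => //; rewrite inE wE imset_f.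
exists (map (fun x : {set 'I_n} * bool => (widen @^-1: (v @: x.1), x.2)) p) => H.
(* Membership in [relabel s H] applies the inverse of [s], so this substitution turns it into
   applying [v] and then [s]. *)
pose a (s : {perm 'I_n}) : {perm 'I_n} := ((v * s)^-1)%g.
have aI : injective a by move=> s s' /invg_inj /mulgI.
rewrite (reindex_inj aI); apply: eq_bigr => s _; congr nat_of_bool.
rewrite /agree all_map; apply: eq_in_all => x xp /=; congr (_ == _).
have wI : injective widen by move=> i j [] E; apply: val_inj.
have vsE : (v * s)%g @: x.1 = s @: (v @: x.1).
  by rewrite -imset_comp; apply: eq_in_imset => i _; rewrite /= permM.
rewrite in_relabel /a invgK vsE inE -(card_imset _ wI) (vr x xp).
rewrite card_imset ?(allP pk x xp) /=; last exact: perm_inj.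
by rewrite -[in LHS](vr x xp) -imset_comp.
Qed.

Lemma paths_pattern q (ps : seq path_t) : (k * q <= r)%N ->
  (forall p, p \in ps -> (size p <= q)%N /\ all (fun x : {set 'I_n} * bool => #|x.1| == k) p) ->
  exists f : {set {set 'I_r}} -> nat, (forall y, (f y <= size ps)%N) /\
  forall H : hgraph n,
    (\sum_(s : {perm 'I_n}) \sum_(p <- ps) agree p (relabel s H) =
     \sum_(s : {perm 'I_n}) f (pullk k (fun i => s (widen i)) H))%N.
Proof.
move=> kq; elim: ps => [|p ps IH] psP.
  by exists (fun=> 0%N); split=> // H; apply: eq_bigr => s _; rewrite big_nil.
have [f [fle fE]] := IH (fun p' p'P => psP p' (mem_behead (s := p :: ps) p'P)).
have [pq pk] := psP p (mem_head _ _); have [p' p'E] := path_pattern kq pq pk.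
exists (fun y => agree p' y + f y)%N; split=> [y|H].
  by rewrite /= -add1n leq_add // leq_b1.
rewrite big_split /= -p'E -fE -big_split; apply: eq_bigr => s _.
by rewrite big_cons.
Qed.

Lemma tree_pattern q (t : qtree n) : (k * q <= r)%N ->
  (qdepth t <= q)%N -> queries_ksets k t ->
  exists f : {set {set 'I_r}} -> nat, (forall y, (f y <= 2 ^ q)%N) /\
  forall H : hgraph n,
    (\sum_(s : {perm 'I_n}) run t (relabel s H) =
     \sum_(s : {perm 'I_n}) f (pullk k (fun i => s (widen i)) H))%N.
Proof.
move=> kq tq tk.
have [f [fle fE]] := paths_pattern kq (fun p => accepting_paths_short tq tk).
exists f; split=> [y|H]; last by rewrite -fE; apply: eq_bigr => s _; rewrite run_paths.
apply: leq_trans (fle y) _; apply: leq_trans (accepting_paths_size t) _.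
by rewrite leq_exp2l.
Qed.

Definition total_weight (A : ralg n) : R := \sum_(p <- A) p.1.

Lemma accept_probE (A : ralg n) H :
  accept_prob A H = \sum_(p <- A) p.1 * (run p.2 H)%:R.
Proof.
elim: A => [|p A IH]; first by rewrite big_nil.
rewrite big_cons /= IH; congr (_ + _); by case: run; rewrite ?mulr1 ?mulr0.
Qed.

Lemma total_weightE (A : ralg n) : foldr (fun p acc => Rplus p.1 acc) (IZR 0) A = total_weight A.
Proof. by elim: A => [|p A /= ->]; rewrite /total_weight ?big_nil ?big_cons. Qed.

(** Linearity over the weighted trees. The total weight is left free because the induction passes to
    the tail of the list, whose weights need not sum to 1. *)
Lemma ralg_pattern q (A : ralg n) : (k * q <= r)%N ->
  foldr (fun p acc => (Rle (IZR 0) p.1 /\ (qdepth p.2 <= q)%N /\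
                        queries_ksets k p.2) /\ acc) True A ->
  exists f : {set {set 'I_r}} -> R,
    (forall y, 0 <= f y <= (2 ^ q)%:R * total_weight A) /\
  forall H : hgraph n,
    \sum_(s : {perm 'I_n}) accept_prob A (relabel s H) =
    \sum_(s : {perm 'I_n}) f (pullk k (fun i => s (widen i)) H).
Proof.
move=> kq; elim: A => [_|p A IH /= [[/RleP p0 [pq pk]] /IH [f [fle fE]]]].
  exists (fun=> 0); split=> [y|H]; first by rewrite /total_weight big_nil mulr0 lexx.
  by apply: eq_bigr => s _; rewrite accept_probE big_nil.
have [g [gle gE]] := tree_pattern kq pq pk.
exists (fun y => p.1 * (g y)%:R + f y); split=> [y|H].
  have /andP[f0 f1] := fle y; rewrite addr_ge0 ?mulr_ge0 ?ler0n //=.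
  rewrite /total_weight big_cons mulrDr; apply: lerD => //.
  by rewrite mulrC ler_wpM2r // ler_nat.
transitivity (\sum_(s : {perm 'I_n})
    (p.1 * (run p.2 (relabel s H))%:R + accept_prob A (relabel s H))).
  by apply: eq_bigr => s _; case: run; rewrite ?mulr1 ?mulr0.
rewrite !big_split /= fE; congr (_ + _).
by rewrite -!mulr_sumr -!natr_sum gE.
Qed.

End Tester.

(** * Empirical means on a sample versus true means *)

Section SampleAnalysis.
Variables (R : archiRealFieldType) (k r s n : nat).
Variables (phi : {set {set 'I_r}} -> R) (B c th : R) (H G : {set {set 'I_n}}).
Hypotheses (kr : (k <= r)%N) (n_gt0 : (0 < n)%N) (s_gt0 : (0 < s)%N).
Hypotheses (c_gt0 : 0 < c) (B_ge1 : 1 <= B) (phiB : forall y, 0 <= phi y <= B).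
Hypothesis s_large : 100 * B ^+ 2 <= s%:R * c ^+ 2.
Local Notation T := ('I_s * 'I_r)%type.
Local Notation edits := (@editK R k r n (gdiff H G)).

Definition deviates (K : {ffun 'I_r -> 'I_n} -> R) (g : {ffun T -> 'I_n}) : bool :=
  c <= `|block_mean K g - mean K|.

Lemma deviates_mean K : (forall h, 0 <= K h <= B) ->
  mean (fun g => (deviates K g)%:R : R) <= 1 / 100.
Proof.
move=> KB; rewrite mean_pred; set S := [set x | _].
have N0 : 0 < #|{ffun T -> 'I_n}|%:R :> R by rewrite ltr0n card_ffun card_ord expn_gt0 n_gt0.
have B0 : 0 < B ^+ 2 by rewrite exprn_gt0 // (lt_le_trans ltr01).
have I0 : (0 < #|'I_s|)%N by rewrite card_ord.
have := block_mean_deviation I0 n_gt0 c_gt0 KB; rewrite card_ord -/S => h.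
rewrite ler_pdivrMr // mulrAC ler_pdivlMr // mul1r -(ler_pM2l B0).
apply: le_trans h; rewrite mulrCA ler_wpM2l ?ler0n //.
by rewrite mulrC.
Qed.

Lemma acceptK_bound (h : {ffun 'I_r -> 'I_n}) : 0 <= acceptK k phi G h <= B.
Proof. exact: phiB. Qed.

Lemma editK_bound (h : {ffun 'I_r -> 'I_n}) : 0 <= edits h <= B.
Proof.
by rewrite /editK ler0n (le_trans _ B_ge1) // lern1 leq_b1.
Qed.

(** Each of the two empirical means is off by [c] or more with probability at most 1/100. *)
Lemma sample_good_complete :
  1 / 2 + c <= mean (acceptK k phi G) -> mean edits <= th - c ->
  mean (fun g : {ffun T -> 'I_n} =>
    (~~ sample_good k phi th (pullk k g H) (pullk k g G))%:R : R) <= 1 / 50.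
Proof.
move=> a1 a2; have d1 := deviates_mean acceptK_bound; have d2 := deviates_mean editK_bound.
apply: (@le_trans _ _ (mean (fun g => (deviates (acceptK k phi G) g)%:R : R) +
   mean (fun g => (deviates edits g)%:R : R))); last by lra.
rewrite /mean -mulrDl -big_split /=; apply: mean_le => g /=.
rewrite sample_good_pull // -natrD ler_nat.
case d1g: (deviates (acceptK k phi G) g); first by apply: leq_trans (leq_b1 _) _.
case d2g: (deviates edits g); first by apply: leq_trans (leq_b1 _) _.
move: d1g d2g; rewrite /deviates => /negbT; rewrite -ltNge ltr_norml => /andP[d1g _].
move=> /negbT; rewrite -ltNge ltr_norml => /andP[_ d2g].
suff -> : (1 / 2 <= block_mean (acceptK k phi G) g) &&
  (block_mean edits g <= th) by [].
by apply/andP; split; lra.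
Qed.

(** Since 1/10 exceeds 2/100, some good sample has both empirical means within [c] of the true
    ones. *)
Lemma sample_good_sound :
  1 / 10 <= mean (fun g : {ffun T -> 'I_n} =>
      (sample_good k phi th (pullk k g H) (pullk k g G))%:R : R) ->
  1 / 2 - c <= mean (acceptK k phi G) /\ mean edits <= th + c.
Proof.
move=> a1; have d1 := deviates_mean acceptK_bound; have d2 := deviates_mean editK_bound.
have [/existsP[g /and3P[]]|/existsPn no] := boolP [exists g : {ffun T -> 'I_n},
   [&& sample_good k phi th (pullk k g H) (pullk k g G),
       ~~ deviates (acceptK k phi G) g & ~~ deviates edits g]].
  rewrite sample_good_pull // => /andP[g1 g2]; rewrite /deviates -!ltNge !ltr_norml.
  by move=> /andP[_ h1] /andP[h2 _]; split; lra.
have : mean (fun g : {ffun T -> 'I_n} =>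
      (sample_good k phi th (pullk k g H) (pullk k g G))%:R : R) <=
   mean (fun g => (deviates (acceptK k phi G) g)%:R : R) +
   mean (fun g => (deviates edits g)%:R : R).
  rewrite /mean -mulrDl -big_split /=; apply: mean_le => g /=.
  rewrite -natrD ler_nat; move: (no g); case: sample_good => //=.
  by case: deviates; case: deviates.
by move=> h; lra.
Qed.

End SampleAnalysis.

(** * Non-adaptive query algorithms *)

Section Algorithms.
Variables (k n : nat).

Fixpoint query_all (es : seq {set 'I_n}) (D : {set {set 'I_n}} -> bool)
    (acc : {set {set 'I_n}}) : qtree n :=
  match es with
  | [::] => Leaf n (D acc)
  | e :: es' => Query e (query_all es' D acc) (query_all es' D (e |: acc))
  end.

Lemma run_query_all es D acc H :
  run (query_all es D acc) H = D (acc :|: [set e in es | e \in H]).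
Proof.
elim: es acc => [|e es IH] acc /=.
  by congr D; apply/setP => x; rewrite !inE orbF.
case eH: (e \in H); rewrite IH; congr D; apply/setP => x; rewrite !inE.
  by have [->|] := eqVneq x e; rewrite ?eH ?orbT.
by have [->|] := eqVneq x e; rewrite ?eH ?andbF.
Qed.

Lemma qdepth_query_all es D acc : qdepth (query_all es D acc) = size es.
Proof. by elim: es acc => //= e es IH acc; rewrite !IH maxnn. Qed.

Lemma ksets_query_all es D acc : all (fun e : {set 'I_n} => #|e| == k) es ->
  queries_ksets k (query_all es D acc).
Proof. by elim: es acc => //= e es IH acc /andP[-> h]; rewrite !IH. Qed.

Definition closeb (P : kproperty) (a : R) (H : hgraph n) : bool :=
  [exists G : hgraph n,
    [&& is_kgraph k G, P n G & #|symdiff G H|%:R <= a * 'C(n, k)%:R]].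

Lemma closebP P a H : reflect (close_to k P a H) (closeb P a H).
Proof.
apply: (iffP existsP) => [[G /and3P[Gk GP /RleP h]]|[G [Gk [GP h]]]]; exists G.
  by do 2!split=> //; rewrite /close !INRE.
by rewrite Gk GP; apply/RleP; move: h; rewrite /close !INRE.
Qed.

Lemma ralg_uniform (F : finType) (q : nat) (tr : F -> qtree n) :
  (0 < #|F|)%N -> (forall f, qdepth (tr f) <= q)%N -> (forall f, queries_ksets k (tr f)) ->
  exists A : ralg n, valid_ralg k q A /\
    forall H, accept_prob A H = mean (fun f => (run (tr f) H)%:R).
Proof.
move=> F0 tq tk; pose A : ralg n := [seq ((#|F|%:R^-1 : R), tr f) | f <- enum F].
exists A; split; last first.
  move=> H; rewrite accept_probE big_map big_enum /mean mulrC mulr_sumr.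
  by apply: eq_bigr.
split; last first.
  rewrite total_weightE /total_weight big_map big_enum /= sumr_const -[LHS]mulr_natr.
  by rewrite mulVf // pnatr_eq0 -lt0n.
rewrite /A; elim: (enum F) => //= f fs IH; split=> //; split=> //.
by apply/RleP; rewrite invr_ge0 ler0n.
Qed.

Lemma kgraph_card (H : hgraph n) : is_kgraph k H -> forall e, e \in H -> #|e| = k.
Proof. by move=> /forall_inP h e eH; apply/eqP/h. Qed.

Lemma exact_alg (q : nat) (D : hgraph n -> bool) : (2 ^ n <= q)%N ->
  exists A : ralg n, valid_ralg k q A /\
    forall H, is_kgraph k H -> accept_prob A H = (D H)%:R.
Proof.
move=> nq; pose es := enum [set e : {set 'I_n} | #|e| == k].
have F0 : (0 < #|{: unit}|)%N by rewrite card_unit.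
have [||A [Av AE]] := @ralg_uniform unit q (fun=> query_all es D set0) F0.
- move=> _; rewrite qdepth_query_all -cardE; apply: leq_trans nq.
  by rewrite -[n in leqRHS](card_ord n) -cardsT -card_powerset subset_leq_card // powersetT.
- by move=> _; apply: ksets_query_all; apply/allP => e; rewrite mem_enum inE.
exists A; split=> // H Hk; rewrite AE /mean card_unit divr1 (big_pred1 tt) => [|[] //].
rewrite run_query_all set0U; congr (nat_of_bool (D _))%:R; apply/setP => e.
rewrite inE mem_enum inE; case eH: (e \in H); rewrite ?andbF ?andbT //.
by rewrite (kgraph_card Hk eH) eqxx.
Qed.

Lemma sampling_alg (V : finType) (q : nat) (D : {set {set V}} -> bool) :
  (0 < n)%N -> (2 ^ #|V| <= q)%N ->
  exists A : ralg n, valid_ralg k q A /\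
    forall H, is_kgraph k H ->
      accept_prob A H = mean (fun f : {ffun V -> 'I_n} => (D (pullk k f H))%:R).
Proof.
(* Only images with [k] elements are queried; for a [k]-graph the collapsed ones are non-edges
   anyway. *)
move=> n0 Vq; pose es (f : {ffun V -> 'I_n}) :=
  filter (fun e : {set 'I_n} => #|e| == k) [seq f @: u | u : {set V}].
have F0 : (0 < #|{ffun V -> 'I_n}|)%N by rewrite card_ffun card_ord expn_gt0 n0.
have [||A [Av AE]] := @ralg_uniform {ffun V -> 'I_n} q
  (fun f => query_all (es f) (fun Q => D (pullk k f Q)) set0) F0.
- move=> f; rewrite qdepth_query_all /es size_filter; apply: leq_trans (count_size _ _) _.
  apply: leq_trans Vq.
  by rewrite size_map -cardE -(cardsT V) -card_powerset powersetT cardsT.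
- by move=> f; apply: ksets_query_all; apply/allP => e; rewrite mem_filter => /andP[].
exists A; split=> // H Hk; rewrite AE; congr (_ / _); apply: eq_bigr => f _.
rewrite run_query_all set0U; congr (nat_of_bool (D _))%:R; apply/setP => e.
rewrite !inE; case: eqP => //= ek; rewrite andb_idl // => eH.
by rewrite mem_filter (kgraph_card Hk eH) eqxx /=; apply/mapP; exists e; rewrite ?mem_enum.
Qed.

End Algorithms.

(** * Estimators *)

Section Relabelling.
Variable n : nat.
Implicit Types (s : {perm 'I_n}) (A B : hgraph n).

Lemma relabelK s A : relabel s^-1%g (relabel s A) = A.
Proof.
apply/setP => e; rewrite !in_relabel invgK -imset_comp; congr (_ \in A).
by rewrite -[RHS]imset_id; apply: eq_in_imset => i _; rewrite /= permK.
Qed.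

Lemma symdiff_relabel s A B : symdiff (relabel s A) (relabel s B) = relabel s (symdiff A B).
Proof. by apply/setP => e; rewrite /symdiff !inE !in_relabel !inE. Qed.

Lemma card_relabel s A : #|relabel s A| = #|A|.
Proof. by rewrite card_imset //; apply: imset_inj; apply: perm_inj. Qed.

Lemma is_kgraph_relabel k s A : is_kgraph k A -> is_kgraph k (relabel s A).
Proof.
move=> Ak; apply/forall_inP => e; rewrite in_relabel => /(kgraph_card Ak) <-.
by rewrite card_imset //; apply: perm_inj.
Qed.

Lemma symdiff_triangle A B (C : hgraph n) :
  (#|symdiff A C| <= #|symdiff A B| + #|symdiff B C|)%N.
Proof.
apply: leq_trans (leq_card_setU _ _); apply: subset_leq_card; apply/subsetP => e.
by rewrite /symdiff !inE; case: (e \in A); case: (e \in B); case: (e \in C).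
Qed.

End Relabelling.

Lemma two_thirdsE : Rdiv (IZR 2) (IZR 3) = 2 / 3 :> R.
Proof. by rewrite RdivE !IZRposE !INRE. Qed.

Lemma close_toE k (P : kproperty) n (a : R) (H : hgraph n) :
  close_to k P a H <->
  exists G : hgraph n,
    [/\ is_kgraph k G, P n G & #|symdiff G H|%:R <= a * 'C(n, k)%:R :> R].
Proof.
split=> [[G [Gk [GP /RleP]]]|[G [Gk GP h]]]; rewrite ?INRE.
  by exists G.
by exists G; do 2!split=> //; apply/RleP; rewrite !INRE.
Qed.

Section Tester.
Variables (k n : nat) (P : kproperty) (e : R) (A : ralg n).
Hypothesis hP : iso_closed k P.
Hypothesis A_complete : forall H : hgraph n, is_kgraph k H -> @P n H -> 2 / 3 <= accept_prob A H.
Hypothesis A_sound : forall H : hgraph n, is_kgraph k H -> ~ close_to k P e H ->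
  accept_prob A H <= 1 / 3.

Definition relabelled_accept (H : hgraph n) : R :=
  mean (fun s : {perm 'I_n} => accept_prob A (relabel s H)).

Lemma relabelled_complete (H : hgraph n) : is_kgraph k H -> @P n H -> 2 / 3 <= relabelled_accept H.
Proof.
move=> Hk HP; have P0 : (0 < #|{: {perm 'I_n}}|)%N by apply/card_gt0P; exists 1%g.
rewrite -(mean_const (2 / 3) P0); apply: mean_le => s.
by apply: A_complete; [apply: is_kgraph_relabel | rewrite hP].
Qed.

(** Some relabelling is accepted with probability above 1/3, hence is close to [P]; the inverse
    relabelling carries the witness back. *)
Lemma relabelled_sound (H : hgraph n) : is_kgraph k H -> 1 / 3 < relabelled_accept H -> close_to k P e H.
Proof.
move=> Hk acc; have P0 : (0 < #|{: {perm 'I_n}}|)%N by apply/card_gt0P; exists 1%g.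
have [s hs] : exists s : {perm 'I_n}, 1 / 3 < accept_prob A (relabel s H).
  apply/existsP; apply: contraLR acc => /existsPn h; rewrite -leNgt.
  rewrite -(mean_const (1 / 3) P0); apply: mean_le => s.
  by rewrite leNgt h.
have : close_to k P e (relabel s H).
  apply: contrapT => /(A_sound (is_kgraph_relabel s Hk)).
  by rewrite leNgt hs.
case/close_toE => G [Gk GP GH]; apply/close_toE; exists (relabel s^-1%g G).
split; [exact: is_kgraph_relabel | by rewrite hP | ].
by rewrite -[X in symdiff _ X](relabelK s) symdiff_relabel card_relabel.
Qed.

End Tester.

(** A graph witnessing closeness passes the sample test. Conversely, acceptance yields by
    [host_sound] a graph within [alpha - beta / 8] of [H] that the tester likes, so it is [e]-close
    to [P]. *)
Lemma estimator_exists k (P : kproperty) (q : nat) (e alpha beta : R) :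
  iso_closed k P -> e <= beta / 8 -> 0 < beta -> beta < alpha -> alpha < 1 ->
  (forall n, exists A : ralg n, valid_ralg k q A /\
     (forall H : hgraph n, is_kgraph k H -> P n H -> 2 / 3 <= accept_prob A H) /\
     (forall H : hgraph n, is_kgraph k H -> ~ close_to k P e H ->
        accept_prob A H <= 1 / 3)) ->
  exists Q, forall n, exists A : ralg n, valid_ralg k Q A /\
     (forall H : hgraph n, is_kgraph k H -> close_to k P (alpha - beta) H ->
        2 / 3 <= accept_prob A H) /\
     (forall H : hgraph n, is_kgraph k H -> ~ close_to k P alpha H ->
        accept_prob A H <= 1 / 3).
Proof.
move=> hP eb b0 ba a1 tester.
(* [k * q] vertices hold the queries of one path, and [k] more leave room for [first_ords]. [B]
   bounds the pattern function and [c] is the precision of empirical means. *)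
pose r := (k * q + k)%N; pose B : R := (2 ^ q)%:R; pose c := beta / 16.
have c0 : 0 < c by rewrite divr_gt0.
have B1 : 1 <= B by rewrite ler1n expn_gt0.
have B0 : 0 < B by apply: lt_le_trans B1.
pose s := (Num.bound (100 * B ^+ 2 / c ^+ 2)).+1.
have s_large : 100 * B ^+ 2 <= s%:R * c ^+ 2.
  rewrite -ler_pdivrMr ?exprn_gt0 //; apply: ltW; apply: lt_le_trans (archi_boundP _) _.
    by rewrite divr_ge0 ?sqr_ge0 // mulr_ge0 ?sqr_ge0.
  by rewrite ler_nat leqnSn.
have kr : (k <= r)%N by rewrite leq_addl.
have kqr : (k * q <= r)%N by rewrite leq_addr.
have [M HM] := host_sound R k r s.
pose V : finType := ('I_s * 'I_r * 'I_M.+1)%type.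
(* From [N1] on, sampling with replacement changes means by at most [beta / 12]. Below [N0] the
   whole graph is queried. *)
pose N1 := Num.bound (B * (r ^ 2)%:R * 12 / beta).
pose N0 := (1 + r + s * r + 10 * (s * r) ^ 2 + N1)%N.
exists (2 ^ N0 + 2 ^ #|V|)%N => n; have [nN|nN] := ltnP n N0.
  have [|A [Av AE]] := @exact_alg k n (2 ^ N0 + 2 ^ #|V|) (closeb k P (alpha - beta)).
    by apply: leq_trans (leq_addr _ _); rewrite leq_exp2l // ltnW.
  exists A; split=> //; split=> H Hk; rewrite AE //.
    by move=> /closebP ->; rewrite mulr1n; lra.
  case: closebP => [cl []|_ _]; last by rewrite mulr0n; lra.
  case/close_toE: cl => G [Gk GP h]; apply/close_toE; exists G; split=> //.
  by apply: le_trans h _; rewrite ler_wpM2r ?ler0n // RminusE; lra.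
have [A0 [[A0v A0s] [A0c A0n]]] := tester n.
have n0 : (0 < n)%N by apply: leq_trans nN; rewrite /N0 -!addnA.
have rn : (r <= n)%N by apply: leq_trans nN; rewrite /N0; lia.
have srn : (s * r <= n)%N by apply: leq_trans nN; rewrite /N0; lia.
have sr2n : (10 * (s * r) ^ 2 <= n)%N by apply: leq_trans nN; rewrite /N0; lia.
have n0' : 0 < n%:R :> R by rewrite ltr0n.
have C0 : 0 < 'C(n, k)%:R :> R by rewrite ltr0n bin_gt0 (leq_trans kr rn).
have small : B * ((r ^ 2)%:R / n%:R) <= beta / 12.
  have h : B * (r ^ 2)%:R * 12 / beta <= n%:R.
    apply: ltW; apply: lt_le_trans (archi_boundP _) _.
      by rewrite divr_ge0 ?(ltW b0) // !mulr_ge0 ?ler0n ?(ltW B0).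
    by rewrite ler_nat; apply: leq_trans nN; rewrite /N0 leq_addl.
  rewrite mulrA ler_pdivrMr //; move: h; rewrite ler_pdivrMr //.
  by set x := B * _; set y := n%:R; lra.
have [phi [phiB phiE]] := ralg_pattern rn kqr A0v.
rewrite total_weightE in A0s; rewrite A0s mulr1 -/B in phiB.
have wI : injective (widen_ord rn) by move=> i j [] E; apply: val_inj.
have acceptE (G : hgraph n) : relabelled_accept A0 G =
    mean (fun p : {perm 'I_n} => acceptK k phi G [ffun i => p (widen_ord rn i)]).
  congr (_ / _); rewrite phiE; apply: eq_bigr => p _; congr phi.
  by apply: eq_pullk => i; rewrite ffunE.
have accept_close (G : hgraph n) :
    relabelled_accept A0 G - beta / 12 <= mean (acceptK k phi G) <=
    relabelled_accept A0 G + beta / 12.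
  have := mean_perm_close wI n0 (@acceptK_bound _ k r n phi B G phiB).
  rewrite -acceptE card_ord => /andP[h1 h2]; apply/andP; split; lra.
have edit_close (H G : hgraph n) : is_kgraph k H -> is_kgraph k G ->
    #|symdiff G H|%:R / 'C(n, k)%:R - beta / 12 <= mean (@editK R k r n (gdiff H G)) <=
    #|symdiff G H|%:R / 'C(n, k)%:R + beta / 12.
  move=> Hk Gk; have := mean_perm_close wI n0 (@editK_bound _ k r n B H G B1).
  have -> : gdiff H G = symdiff G H by rewrite /gdiff /symdiff setUC.
  have Dk (u : {set 'I_n}) : u \in symdiff G H -> #|u| = k.
    by rewrite !inE => /orP[] /andP[_]; apply: kgraph_card.
  have Wk : #|widen_ord rn @: first_ords k r| = k by rewrite card_imset ?card_first_ords.
  rewrite -(edge_perm_mean R Dk Wk) card_ord.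
  have -> : mean (fun p : {perm 'I_n} => (p @: (widen_ord rn @: first_ords k r) \in symdiff G H)%:R) =
      mean (fun p : {perm 'I_n} => editK R k (symdiff G H) [ffun i => p (widen_ord rn i)]).
    congr (_ / _); apply: eq_bigr => p _; rewrite /editK.
    suff -> : [ffun i => p (widen_ord rn i)] @: first_ords k r =
      p @: (widen_ord rn @: first_ords k r) by [].
    by rewrite -imset_comp; apply: eq_imset => i; rewrite ffunE.
  by move=> /andP[h1 h2]; apply/andP; split; lra.
(* The slack [beta / 2] on either side absorbs [c] and [beta / 12], and for soundness also [e]. *)
pose th := alpha - beta / 2.
have [|A [Av AE]] := @sampling_alg k n V (2 ^ N0 + 2 ^ #|V|) (host_good k phi th) n0.
  exact: leq_addl.
exists A; split=> //; split=> H Hk; rewrite AE //.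
  case/close_toE => G [Gk GP GH]; rewrite RminusE in GH.
  have acc := relabelled_complete hP A0c Gk GP.
  have /andP[acc1 _] := accept_close G; have /andP[_ ed] := edit_close H G Hk Gk.
  have GH' : #|symdiff G H|%:R / 'C(n, k)%:R <= alpha - beta :> R by rewrite ler_pdivrMr.
  have h : 4 / 5 <= mean (fun f : {ffun V -> 'I_n} => (host_good k phi th (pullk k f H))%:R : R).
    apply: (host_complete (G := G) M n0); apply: (sample_good_complete kr n0 _ c0 B1 phiB s_large) => //.
      by rewrite /c; lra.
    by rewrite /th /c; lra.
  by apply: le_trans h; lra.
move=> far; rewrite leNgt; apply/negP => acc; apply: far.
have [G [Gk good]] := HM n phi th H kr n0 sr2n srn (ltW acc).
have Gk' : is_kgraph k G by apply/forall_inP => u uG; apply/eqP; apply: Gk.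
have [h1 h2] := sample_good_sound kr n0 (ltn0Sn _) c0 B1 phiB s_large good.
have /andP[_ acc1] := accept_close G; have /andP[ed _] := edit_close H G Hk Gk'.
have : close_to k P e G.
  by apply: (relabelled_sound hP A0n Gk'); move: h1; rewrite /c; lra.
case/close_toE => G' [G'k G'P G'G]; apply/close_toE; exists G'; split=> //.
apply: (@le_trans _ _ (#|symdiff G' G|%:R + #|symdiff G H|%:R)).
  by rewrite -natrD ler_nat symdiff_triangle.
apply: (@le_trans _ _ (e * 'C(n, k)%:R + (alpha - beta / 8) * 'C(n, k)%:R)).
  apply: lerD => //; rewrite -ler_pdivrMr //; move: h2; rewrite /th /c; lra.
by rewrite -mulrDl; apply: ler_wpM2r; [exact: ler0n | lra].
Qed.

(** * The two implications *)

Lemma reject_probE (x : R) : Rge (Rminus (IZR 1) x) (Rdiv (IZR 2) (IZR 3)) <-> x <= 1 / 3.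
Proof.
rewrite two_thirdsE RminusE; split=> [/Rge_le/RleP h|h].
  by move: h; rewrite (R1E : IZR 1 = 1); lra.
by apply: Rle_ge; apply/RleP; rewrite (R1E : IZR 1 = 1); lra.
Qed.

Lemma testable_estimator k (P : kproperty) (alpha beta : R) :
  iso_closed k P -> testable k P -> 0 < beta -> beta < alpha -> alpha < 1 ->
  exists Q, forall n, exists A : ralg n, valid_ralg k Q A /\
     (forall H : hgraph n, is_kgraph k H -> close_to k P (Rminus alpha beta) H ->
        Rle (Rdiv (IZR 2) (IZR 3)) (accept_prob A H)) /\
     (forall H : hgraph n, is_kgraph k H -> ~ close_to k P alpha H ->
        Rge (Rminus (IZR 1) (accept_prob A H)) (Rdiv (IZR 2) (IZR 3))).
Proof.
move=> hP [q tq] b0 ba a1; pose e := beta / 8.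
have e01 : Rlt (IZR 0) e /\ Rlt e (IZR 1).
  split; apply/RltP; rewrite /e; first by rewrite (R0E : IZR 0 = 0) divr_gt0.
  by rewrite (R1E : IZR 1 = 1); lra.
have [|Q HQ] := @estimator_exists k P (q e) e alpha beta hP (lexx _) b0 ba a1.
  move=> n; have [A [Av [Ac As]]] := tq n e e01; exists A; split=> //; split=> H Hk h.
    by rewrite -two_thirdsE; apply/RleP; apply: Ac.
  by apply/reject_probE; apply: As.
exists Q => n; have [A [Av [Ac As]]] := HQ n; exists A; split=> //; split=> H Hk h.
  by apply/RleP; rewrite two_thirdsE; apply: Ac.
by apply/reject_probE; apply: As.
Qed.

(** With [beta = alpha / 2]: a graph satisfying [P] is at distance 0 from itself, hence close with
    parameter [alpha - beta]. *)
Lemma estimable_testable k (P : kproperty) : estimable k P -> testable k P.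
Proof.
move=> [q eq]; pose half (a : R) := a / 2.
exists (fun a => q a (half a)) => n a [/RltP a0 a1].
rewrite (R0E : IZR 0 = 0) in a0.
have a2 : Rlt (IZR 0) (half a).
  by apply/RltP; rewrite (R0E : IZR 0 = 0) divr_gt0.
have a2' : Rlt (half a) a by apply/RltP; rewrite /half; lra.
have [A [Av [Ac As]]] := eq n a (half a) a2 a2' a1.
exists A; split=> //; split=> // H Hk HP; apply: Ac => //.
apply/close_toE; exists H; split=> //.
rewrite (_ : symdiff H H = set0) ?cards0; last by rewrite /symdiff setDv setU0.
by rewrite RminusE mulr_ge0 ?ler0n // /half; lra.
Qed.

Local Close Scope ring_scope.
Unset Implicit Arguments.

Theorem theorem7p1 (k : nat) (hk : (2 <= k)%N) (P : kproperty)
  (hP : iso_closed k P) :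
  testable k P <-> estimable k P.
Proof.
split=> [tP|]; last exact: estimable_testable.
(* The query bound must be a function of all real pairs; [good] is vacuous outside the admissible
   range, so that [choice] applies. *)
pose good (ab : R * R) (Q : nat) : Prop :=
  Rlt (IZR 0) ab.2 -> Rlt ab.2 ab.1 -> Rlt ab.1 (IZR 1) -> forall n,
  exists A : ralg n, valid_ralg k Q A /\
   (forall H : hgraph n, is_kgraph k H -> close_to k P (Rminus ab.1 ab.2) H ->
      Rle (Rdiv (IZR 2) (IZR 3)) (accept_prob A H)) /\
   (forall H : hgraph n, is_kgraph k H -> ~ close_to k P ab.1 H ->
      Rge (Rminus (IZR 1) (accept_prob A H)) (Rdiv (IZR 2) (IZR 3))).
have goodP : forall ab, exists Q, good ab Q.
  move=> [a b].
  have [[/RltP b0 [/RltP ba /RltP a1]]|no] := pselect (Rlt (IZR 0) b /\ Rlt b a /\ Rlt a (IZR 1)); last first.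
    by exists 0 => h1 h2 h3; case: no.
  have [Q HQ] := testable_estimator hP tP b0 ba a1.
  by exists Q.
have [f fP] := choice goodP.
by exists (fun a b => f (a, b)) => n a b b0 ba a1; apply: (fP (a, b)).
Qed.
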